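(* Let $(I\times F,\ \overline g=\beta\,dt^2+g_t)$ be a monotone Riemannian manifold. Then every compact minimal submanifold $S$ of $(I\times F,\overline g)$ is contained in a level hypersurface $\{t=t_0\}$ for some $t_0\in I$. Moreover, if the codimension of $S$ in $I\times F$ is higher than one, then $S$ is a minimal submanifold of $(F,g_{t_0})$ (identifying $\{t=t_0\}$ with $F$).
   Context: Setting: $I\subseteq\mathbb R$ is an open interval, $F$ is a smooth manifold, $(g_t)_{t\in I}$ is a smooth one-parameter family of Riemannian metrics on $F$, $\beta\in C^\infty(I)$ is positive, and $I\times F$ carries the metric $\overline g=\beta\,dt^2+g_t$. Write $\partial_t g_t$ for $\mathcal L_{\partial_t}g_t$, the $t$-derivative of the family $g_t$. The manifold is non-shrinking throughout $\partial_t$ if $\partial_t\beta\ge 0$ and $(\partial_t g_t)(X,X)\ge 0$ for all $t\in I$ and all vectors $X$ tangent to $F$. It is non-expanding throughout $\partial_t$ if it is non-shrinking throughout $-\partial_t$ (i.e. $\partial_t\beta\le 0$ and $(\partial_t g_t)(X,X)\le 0$). It is monotone if it is non-shrinking or non-expanding throughout $\partial_t$. Submanifolds are immersed, connected, of dimension at least one, and compact submanifolds have no boundary. A submanifold is minimal if its mean curvature vector field vanishes identically. ''Contained in'' refers to the image of the immersion. *)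

(* Defs.v *)
From HB Require Import structures.
From mathcomp Require Import all_boot all_order all_algebra.
From mathcomp Require Import all_classical all_reals all_analysis.
Import Order.TTheory GRing.Theory Num.Theory.
Import numFieldNormedType.Exports.

Set Implicit Arguments.
Unset Strict Implicit.
Unset Printing Implicit Defensive.

Local Open Scope classical_set_scope.
Local Open Scope ring_scope.

Section smooth_on.
Context {R : realType}.

(* Differentiability of all iterated directional derivatives; since it entails
   continuity, this is C^oo on an open U when V is finite-dimensional.  Only
   the values of f on the open set U matter. *)
Definition smooth_on (V W : normedModType R) (U : set V) (f : V -> W) :=
  forall (s : seq V) (x : V), U x ->
    differentiable (foldl (fun h v => 'D_v h) f s) x.

Section lemmas.
Context {V W : normedModType R}.
Implicit Types (U : set V) (f g : V -> W).

Lemma smooth_onP U f : smooth_on U f <->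
  (forall x, U x -> differentiable f x) /\ forall v, smooth_on U ('D_v f).
Proof.
split=> [sf|[df sf] [|v s] x Ux]; last 2 first.
- exact: df.
- exact: (sf v s x Ux).
by split=> [x Ux|v s x Ux]; [exact: (sf [::])|exact: (sf (v :: s))].
Qed.

Lemma near_eq_differentiable f g x : {near x, f =1 g} ->
  differentiable f x -> differentiable g x.
Proof.
move=> fg df.
have fgx : f x = g x by exact: nbhs_singleton fg.
have H : g \o shift x = cst (g x) + 'd f x +o_ (0 : V) id.
  apply/eqaddoP => e e0.
  have /eqaddoP/(_ e e0) := diff_locally df.
  rewrite -fgx; apply: filter_app.
  move: fg; rewrite (near_shift 0 x) subr0; apply: filterS => y /= fgy.
  by rewrite !fctE /= fgy.
have cdf := diff_continuous df.
have dg : 'd g x = 'd f x :> (V -> W) by exact: diff_unique cdf H.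
by apply/diff_locallyP; rewrite dg; split.
Qed.

Lemma eq_derive_open U f g v : open U -> {in U, f =1 g} ->
  {in U, 'D_v f =1 'D_v g}.
Proof.
move=> oU fg x /set_mem Ux.
apply: near_eq_derive => //.
by apply: filterS (open_nbhs_nbhs (conj oU Ux)) => y Uy; apply/fg/mem_set.
Qed.

Lemma eq_iter_derive U f g s : open U -> {in U, f =1 g} ->
  (forall x, U x -> differentiable (foldl (fun h v => 'D_v h) f s) x) ->
  forall x, U x -> differentiable (foldl (fun h v => 'D_v h) g s) x.
Proof.
move=> oU; elim: s f g => [|v s IH] f g fg df x Ux /=; last first.
  by apply: (IH ('D_v f)) => //; exact: eq_derive_open.
apply: near_eq_differentiable (df x Ux).
by apply: filterS (open_nbhs_nbhs (conj oU Ux)) => y Uy; apply/fg/mem_set.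
Qed.

Lemma eq_smooth_on U f g : open U -> {in U, f =1 g} ->
  smooth_on U f -> smooth_on U g.
Proof. by move=> oU fg sf s; exact: (eq_iter_derive oU fg (sf s)). Qed.

Lemma smooth_onD U f g : open U ->
  smooth_on U f -> smooth_on U g -> smooth_on U (f \+ g).
Proof.
move=> oU + + s; elim: s f g => [|v s IH] f g sf sg.
  by move=> x Ux; apply: differentiableD; [exact: (sf [::])|exact: (sg [::])].
have [df sDf] := (smooth_onP U f).1 sf; have [dg sDg] := (smooth_onP U g).1 sg.
apply: (@eq_iter_derive U ('D_v f \+ 'D_v g) ('D_v (f + g)) s) => // [y /set_mem Uy|].
  by rewrite deriveD//; apply: diff_derivable; [exact: df|exact: dg].
exact: IH.
Qed.

Lemma smooth_on_cst U (c : W) : smooth_on U (cst c).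
Proof.
move=> s; elim: s c => [|v s IH] c x Ux /=; first exact: differentiable_cst.
suff -> : 'D_v (cst c) = cst 0 :> (V -> W) by exact: IH.
by apply/funext => y; rewrite derive_cst.
Qed.

Lemma smooth_on_linear U (L : {linear V -> W}) : continuous L ->
  smooth_on U L.
Proof.
move=> cL [|v s] x Ux /=; first exact: linear_differentiable.
suff -> : 'D_v L = cst (L v) by exact: (@smooth_on_cst U).
by apply/funext => y; rewrite deriveE ?diff_lin//; exact: linear_differentiable.
Qed.
End lemmas.

Lemma smooth_on_linear_comp (V W X : normedModType R) (U : set V) (f : V -> W)
    (L : {linear W -> X}) : open U -> continuous L ->
  smooth_on U f -> smooth_on U (L \o f).
Proof.
move=> oU cL + s; elim: s f => [|v s IH] f sf.
  move=> x Ux; apply: differentiable_comp; first exact: (sf [::]).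
  exact: linear_differentiable.
have [df sDf] := (smooth_onP U f).1 sf.
apply: (@eq_iter_derive _ _ U (L \o 'D_v f) ('D_v (L \o f)) s) => // [y /set_mem Uy|]; last first.
  exact: IH.
have dfy := df _ Uy.
have dL : differentiable L (f y) by exact: linear_differentiable.
have dLf : differentiable (L \o f) y by exact: differentiable_comp.
have -> : 'D_v (L \o f) y = 'd (L \o f) y v by exact: deriveE.
have -> : 'd (L \o f) y v = 'd L (f y) ('d f y v).
  by rewrite (diff_comp dfy dL).
by rewrite diff_lin//= (_ : 'D_v f y = 'd f y v)//; exact: deriveE.
Qed.

Lemma smooth_on_comp_linear (V W X : normedModType R) (U : set W) (f : W -> X)
    (L : {linear V -> W}) : continuous L ->
  smooth_on U f -> smooth_on (L @^-1` U) (f \o L).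
Proof.
move=> cL + s; elim: s f => [|v s IH] f sf x Ux.
  apply: differentiable_comp; first exact: linear_differentiable.
  exact: (sf [::]).
have [df sDf] := (smooth_onP U f).1 sf.
rewrite /=; suff -> : 'D_v (f \o L) = 'D_(L v) f \o L by exact: IH.
apply/funext => y; rewrite /derive; apply: (congr1 (fun k : R -> X => lim (k @ 0^'))).
by apply/funext => h /=; rewrite linearP.
Qed.
End smooth_on.

Section manifold.
Context {R : realType}.

(* Smooth n-manifolds without boundary.  The type chart indexes an atlas, which
   need not be maximal.  param a is the inverse of coord a; its values outside
   coord a @` dom a are irrelevant. *)
Record manifold (n : nat) := Manifold {
  carrier :> topologicalType;
  chart : Type;
  dom : chart -> set carrier;
  coord : chart -> carrier -> 'rV[R]_n;
  param : chart -> 'rV[R]_n -> carrier;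
  manifold_hausdorff : hausdorff_space carrier;
  manifold_second_countable : @second_countable carrier;
  dom_cover : forall p, exists a, dom a p;
  dom_open : forall a, open (dom a);
  image_open : forall a, open (coord a @` dom a);
  coordK : forall a p, dom a p -> param a (coord a p) = p;
  coord_continuous_at : forall a p, dom a p -> {for p, continuous (coord a)};
  param_continuous_at : forall a p, dom a p ->
    {for coord a p, continuous (param a)};
  transition_smooth : forall a b,
    smooth_on (coord a @` (dom a `&` dom b)) (coord b \o param a) }.

Lemma overlap_open n (M : manifold n) (a b : chart M) :
  open (coord a @` (dom a `&` dom b)).
Proof.
rewrite openE => _ [p [ap bp] <-].
have cp : nbhs (coord a p) (coord a @` dom a).
  by apply: open_nbhs_nbhs; split; [exact: image_open|exists p].
have bp' : nbhs (param a (coord a p)) (dom b).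
  by rewrite coordK//; apply: open_nbhs_nbhs; split; [exact: dom_open|].
have := param_continuous_at ap bp'; apply: filterS2 cp => _ [q aq <-] /=.
by rewrite coordK// => bq; exists q.
Qed.

End manifold.
Arguments manifold : clear implicits.

Section topology_lemmas.

Lemma hausdorff_prod (T U : topologicalType) :
  hausdorff_space T -> hausdorff_space U -> hausdorff_space (T * U)%type.
Proof.
move=> hT hU [p1 p2] [q1 q2] pq; congr pair.
- apply: hT => A B pA qB.
  have pA' : nbhs (p1, p2) (A `*` setT).
    by exists (A, setT) => //; split => //; exact: filterT.
  have qB' : nbhs (q1, q2) (B `*` setT).
    by exists (B, setT) => //; split => //; exact: filterT.
  by have [[r _] [[/= ? _] [/= ? _]]] := pq _ _ pA' qB'; exists r.
- apply: hU => A B pA qB.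
  have pA' : nbhs (p1, p2) (setT `*` A).
    by exists (setT, A) => //; split => //; exact: filterT.
  have qB' : nbhs (q1, q2) (setT `*` B).
    by exists (setT, B) => //; split => //; exact: filterT.
  by have [[_ r] [[_ /= ?] [_ /= ?]]] := pq _ _ pA' qB'; exists r.
Qed.

Lemma second_countable_prod (T U : topologicalType) :
  @second_countable T -> @second_countable U ->
  @second_countable (T * U)%type.
Proof.
move=> [B cB [oB bB]] [C cC [oC bC]].
exists ((fun XY => XY.1 `*` XY.2) @` (B `*` C)).
  by apply: (card_le_trans (card_image_le _ _)); exact: countableX.
split=> [_ [[X Y] [/= BX CY] <-]|[x y] A [[P Q] /= [xP yQ] PQA]].
  rewrite openE => -[x y] [/= Xx Yy]; exists (X, Y) => //=.
  by split; apply: open_nbhs_nbhs; split => //; [exact: oB|exact: oC].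
have [X [BX Xx] XP] := bB _ _ xP; have [Y [CY Yy] YQ] := bC _ _ yQ.
exists (X `*` Y).
  by split=> //; exists (X, Y).
by move=> [z1 z2] [/= /XP ? /YQ ?]; exact: PQA.
Qed.

Lemma hausdorff_set_type (T : topologicalType) (A : set T) :
  hausdorff_space T -> hausdorff_space (set_type A).
Proof.
move=> hT p q pq; apply: val_inj; apply: hT => X Y pX qY.
have cv := @initial_continuous _ _ (set_val : A -> T).
by have [r [? ?]] := pq _ _ (cv p X pX) (cv q Y qY); exists (val r).
Qed.

Lemma second_countable_set_type (T : topologicalType) (A : set T) :
  @second_countable T -> @second_countable (set_type A).
Proof.
move=> [B cB [oB bB]].
exists ((fun X => (set_val : A -> T) @^-1` X) @` B).
  by apply: (card_le_trans (card_image_le _ _)).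
split=> [_ [X BX <-]|x Y [_ [[Z oZ <-] Zx] ZY]].
  by exists X => //; exact: oB.
have [X [BX Xx] XZ] := bB _ _ (open_nbhs_nbhs (conj oZ Zx)).
exists (set_val @^-1` X); first by split => //; exists X.
by move=> z Xz; apply: ZY; exact: XZ.
Qed.

Lemma second_countable_R (R : realType) : @second_countable R.
Proof.
exists ((fun q : rat * nat => ball (ratr q.1 : R) (q.2.+1%:R^-1)) @` setT).
  by apply: (card_le_trans (card_image_le _ _)); exact: countableP.
split=> [_ [[q n] _ <-]|x A /nbhs_ballP[e /= e0 eA]].
  by apply: ball_open; rewrite invr_gt0.
have e20 : 0 < e / 2 by rewrite divr_gt0.
have [n] := ltr_add_invr e20; rewrite add0r => ne.
have n0 : 0 < n.+1%:R^-1 :> R by rewrite invr_gt0.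
have /rat_in_itvoo[q] : x < x + n.+1%:R^-1 by rewrite ltrDl.
rewrite in_itv/= => /andP[xq qx].
have xqn : ball (ratr q : R) n.+1%:R^-1 x.
  by rewrite /ball /= gtr0_norm ?subr_gt0// ltrBlDl.
exists (ball (ratr q : R) n.+1%:R^-1); first by split => //; exists (q, n).
move=> y qy; apply: eA; rewrite (splitr e).
by apply: ball_triangle (le_ball (ltW ne) qy); apply/ball_sym/(le_ball (ltW ne)).
Qed.

Lemma cvg_mx (T : Type) (F : set_system T) {FF : Filter F} (U : topologicalType)
    m n (f : T -> 'M[U]_(m, n)) (M : 'M[U]_(m, n)) :
  (forall i j, (fun x => f x i j) @ F --> M i j) -> f @ F --> M.
Proof.
move=> fM A [P MP PA]; rewrite /nbhs /=.
have : \forall x \near F, forall ij : 'I_m * 'I_n, P ij.1 ij.2 (f x ij.1 ij.2).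
  by apply: filter_forall => -[i j]; exact: (fM i j _ (MP i j)).
by apply: filterS => x xP; apply: PA => i j; exact: (xP (i, j)).
Qed.

Lemma mulmxr_continuous (R : realType) m n p (A : 'M[R]_(n, p)) :
  continuous (mulmxr A : 'M[R]_(m, n) -> 'M[R]_(m, p)).
Proof.
move=> M; apply: (@cvg_mx _ (nbhs M) (nbhs_filter M)) => i j.
rewrite /= mxE; under eq_fun do rewrite mxE.
have -> : (fun N : 'M[R]_(m, n) => \sum_k N i k * A k j) =
    \sum_k (fun N : 'M[R]_(m, n) => N i k * A k j).
  by apply/funext => N; rewrite fct_sumE.
apply: (big_ind2 (fun (f : 'M[R]_(m, n) -> R) (l : R) => f @ M --> l)).
- exact: (@cvg_cst R (0 : R) _ (nbhs M) _).
- by move=> f l g k fl gk; apply: (@cvgD _ R^o _ (nbhs M) _ f g l k).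
- move=> k _; apply: (@cvgM R _ (nbhs M) _ (fun N : 'M[R]_(m, n) => N i k)
    (cst (A k j)) (M i k) (A k j)); last exact: cvg_cst.
  exact: (@coord_continuous R m n i k M).
Qed.
End topology_lemmas.

Section product_manifold.
Context {R : realType} (I : set R) (oI : open I) (m : nat) (F : manifold R m).
Local Notation T := (set_type I).

(* I x F with the product atlas.  A chart (t, a) is id x a: its component t : I
   is only the junk value of the inverse at first coordinates outside I. *)
Definition prod_dom (a : T * chart F) : set (T * F) :=
  [set p | dom a.2 p.2].

Definition prod_coord (a : T * chart F) (p : T * F) : 'rV[R]_(1 + m) :=
  row_mx (\val p.1)%:M (coord a.2 p.2).

Definition prod_param (a : T * chart F) (y : 'rV[R]_(1 + m)) : T * F :=
  (insubd a.1 (lsubmx y 0 0), param a.2 (rsubmx y)).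

Let prod_imageE a (D : set F) : prod_coord a @` [set p | D p.2] =
  [set y | I (lsubmx y 0 0) /\ (coord a.2 @` D) (rsubmx y)].
Proof.
apply/seteqP; split=> [_ [[t p] /= pa <-]|y [/= It [p pa py]]].
  rewrite /prod_coord/= row_mxKl row_mxKr mxE eqxx mulr1n.
  by split; [exact/set_mem/(valP t)|exists p].
exists (SigSub (mem_set It) : T, p) => //.
rewrite /prod_coord/= py -[RHS]hsubmxK; congr row_mx.
by apply/rowP => i; rewrite !ord1 !mxE eqxx mulr1n.
Qed.

Let prod_image a : prod_coord a @` prod_dom a =
  [set y | I (lsubmx y 0 0) /\ (coord a.2 @` dom a.2) (rsubmx y)].
Proof. exact: prod_imageE. Qed.

Let open_image (a : T * chart F) (U : set 'rV[R]_m) : open U ->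
  open [set y : 'rV[R]_(1 + m) | I (lsubmx y 0 0) /\ U (rsubmx y)].
Proof.
move=> oU; apply: (@openI _ ((fun y : 'rV[R]_(1 + m) => lsubmx y 0 0) @^-1` I)
  (rsubmx @^-1` U)).
  apply: open_comp; last exact: oI.
  move=> y _; apply: (continuous_comp (g := fun M : 'M[R]_(1, 1) => M 0 0)).
    exact: continuous_lsubmx.
  exact: coord_continuous.
by apply: open_comp => // y _; exact: continuous_rsubmx.
Qed.


Let coord0 : continuous (fun y : 'rV[R]_(1 + m) => lsubmx y 0 0).
Proof.
move=> y; apply: (continuous_comp (g := fun M : 'M[R]_(1, 1) => M 0 0)).
  exact: continuous_lsubmx.
exact: coord_continuous.
Qed.

Let prod_coordK a p : prod_dom a p -> prod_param a (prod_coord a p) = p.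
Proof.
case: p => t p; rewrite /prod_dom /prod_param /prod_coord /= => ap.
rewrite row_mxKl row_mxKr mxE eqxx mulr1n valKd.
by rewrite coordK.
Qed.

Let prod_coord_continuous a p : prod_dom a p ->
  {for p, continuous (prod_coord a)}.
Proof.
case: p => t p; rewrite /prod_dom /= => ap.
apply: (@cvg_mx _ (nbhs (t, p)) (nbhs_filter (t, p))) => i j.
rewrite ord1 -(splitK j); case: (fintype.split j) => k /=.
  have E q : prod_coord a q 0 (lshift m k) = \val q.1.
    by rewrite row_mxEl ord1 mxE eqxx mulr1n.
  rewrite (funext E) E.
  apply: (@cvg_comp _ _ _ fst (set_val : T -> R) _ (nbhs t)); first exact: cvg_fst.
  exact: (@initial_continuous _ _ (set_val : T -> R)).
have E q : prod_coord a q 0 (rshift 1 k) = coord a.2 q.2 0 k.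
  by rewrite row_mxEr.
rewrite (funext E) E.
apply: (@cvg_comp _ _ _ snd (fun q => coord a.2 q 0 k) _ (nbhs p)).
  exact: cvg_snd.
apply: (continuous_comp (g := fun v : 'rV[R]_m => v 0 k)).
  exact: coord_continuous_at.
exact: coord_continuous.
Qed.

Let prod_param_continuous a p : prod_dom a p ->
  {for prod_coord a p, continuous (prod_param a)}.
Proof.
case: p => t p ap.
set z := prod_coord a (t, p).
have c1 : {for z, continuous (fun y : 'rV[R]_(1 + m) =>
    insubd a.1 (lsubmx y 0 0) : T)}.
  move=> U [_ [[W oW <-] Wt] WU].
  have It : I (lsubmx z 0 0).
    by rewrite row_mxKl mxE eqxx mulr1n; exact/set_mem/(valP t).
  have IWz : (I `&` W) (lsubmx z 0 0).
    by split=> //; move: Wt; rewrite /= set_valE insubdK//; exact/mem_set.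
  have H : \forall y \near z, (I `&` W) (lsubmx y 0 0).
    exact: (@coord0 z _ (open_nbhs_nbhs (conj (openI oI oW) IWz))).
  apply: (@filterS _ (nbhs z) _ _ _ _ H) => y /= [Iy Wy]; apply: WU => /=.
  by rewrite set_valE /= insubdK//; exact/mem_set.
have c2 : {for z, continuous (fun y : 'rV[R]_(1 + m) => param a.2 (rsubmx y))}.
  apply: continuous_comp; first exact: continuous_rsubmx.
  by rewrite /z /= row_mxKr; exact: param_continuous_at.
move=> U [[A B] /= [nA nB] AB].
apply: (@filterS2 _ (nbhs z) _ _ _ _ _ (c1 A nA) (c2 B nB)) => y Ay By.
exact: AB.
Qed.

Let prod_transition_smooth a b :
  smooth_on (prod_coord a @` (prod_dom a `&` prod_dom b))
    (prod_coord b \o prod_param a).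
Proof.
have -> : prod_coord a @` (prod_dom a `&` prod_dom b) =
    [set y | I (lsubmx y 0 0) /\ (coord a.2 @` (dom a.2 `&` dom b.2)) (rsubmx y)].
  exact: prod_imageE.
set U := [set y | _].
have oU : open U by exact: (open_image a (@overlap_open R m F a.2 b.2)).
pose L1 : 'M[R]_(1 + m) := block_mx 1%:M 0 0 0.
pose L2 : 'M[R]_(m, 1 + m) := row_mx 0 1%:M.
pose h := coord b.2 \o param a.2.
apply: (@eq_smooth_on _ _ _ U (mulmxr L1 \+ (mulmxr L2 \o (h \o rsubmx)))) => //.
  move=> y /set_mem [Iy _].
  rewrite /= /prod_coord /prod_param /= insubdK; last exact/mem_set.
  rewrite -{1}(hsubmxK y) mul_row_block !mulmx0 !addr0 mulmx1.
  rewrite mul_mx_row mulmx0 mulmx1 add_row_mx addr0 add0r; congr row_mx.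
  by apply/rowP => i; rewrite !ord1 !mxE eqxx mulr1n.
apply: smooth_onD => //.
  by apply: smooth_on_linear; exact: mulmxr_continuous.
apply: smooth_on_linear_comp => //; first exact: mulmxr_continuous.
move=> s y [_ Uy].
apply: (@smooth_on_comp_linear _ _ _ _ (coord a.2 @` (dom a.2 `&` dom b.2))) => //.
  exact: continuous_rsubmx.
exact: transition_smooth.
Qed.

Let prod_hausdorff : hausdorff_space (T * F)%type.
Proof.
apply: hausdorff_prod; last exact: manifold_hausdorff.
exact/hausdorff_set_type/Rhausdorff.
Qed.

Let prod_second_countable : @second_countable (T * F)%type.
Proof.
apply: second_countable_prod; last exact: manifold_second_countable.
exact/second_countable_set_type/second_countable_R.
Qed.

Let prod_dom_cover p : exists a, prod_dom a p.
Proof. by case: p => t p; have [a ap] := dom_cover p; exists (t, a). Qed.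

Let prod_dom_open a : open (prod_dom a).
Proof.
apply: (@open_comp _ _ snd) => [p _|]; last exact: dom_open.
exact: cvg_snd.
Qed.

Let prod_image_open a : open (prod_coord a @` prod_dom a).
Proof. by rewrite prod_imageE; apply/(open_image a)/image_open. Qed.

Definition prod_manifold : manifold R (1 + m) :=
  @Manifold R (1 + m) (T * F)%type (T * chart F)%type
    prod_dom prod_coord prod_param
    prod_hausdorff prod_second_countable prod_dom_cover prod_dom_open
    prod_image_open prod_coordK prod_coord_continuous prod_param_continuous
    prod_transition_smooth.

End product_manifold.

Section riemannian.
Context {R : realType}.

Definition qform n (A : 'M[R]_n) (v : 'rV[R]_n) : R := (v *m A *m v^T) 0 0.

(* A (0,2)-tensor field given by its components: g a y is its Gram matrix, at
   the point with coordinates y, in the coordinate frame of the chart a. *)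
Definition tensor n (M : manifold R n) := chart M -> 'rV[R]_n -> 'M[R]_n.

(* The Jacobian 'J f y acts on row vectors: 'd f y v = v *m 'J f y. *)
Definition riemannian_metric n (M : manifold R n) (g : tensor M) : Prop :=
  [/\ forall a p, dom a p -> (g a (coord a p))^T = g a (coord a p),
      forall a p v, dom a p -> v != 0 -> 0 < qform (g a (coord a p)) v,
      forall a, smooth_on (coord a @` dom a) (g a) &
      forall a b p, dom a p -> dom b p ->
        let J := 'J (coord b \o param a) (coord a p) in
        g a (coord a p) = J *m g b (coord b p) *m J^T].

Definition local_rep k n (S : manifold R k) (M : manifold R n) (f : S -> M)
  (a : chart S) (b : chart M) : 'rV[R]_k -> 'rV[R]_n :=
  coord b \o f \o param a.

Definition smooth_map k n (S : manifold R k) (M : manifold R n) (f : S -> M) :=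
  continuous f /\
  forall a b,
    smooth_on (coord a @` (dom a `&` f @^-1` dom b)) (local_rep f a b).

Definition immersion k n (S : manifold R k) (M : manifold R n) (f : S -> M) :=
  smooth_map f /\
  forall a b p, dom a p -> dom b (f p) ->
    row_free ('J (local_rep f a b) (coord a p)).

Section coordinates.
Variables (k n : nat) (G : 'rV[R]_n -> 'M[R]_n) (phi : 'rV[R]_k -> 'rV[R]_n).

Definition pderiv m (W : normedModType R) (i : 'I_m) (f : 'rV[R]_m -> W) :
  'rV[R]_m -> W := 'D_(delta_mx 0 i) f.

(* Gamma^a_{bc} *)
Definition christoffel (y : 'rV[R]_n) (a b c : 'I_n) : R :=
  2^-1 * \sum_(e < n) invmx (G y) a e *
    (pderiv b G y e c + pderiv c G y e b - pderiv e G y b c).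

(* The ambient covariant derivative of d_j phi along d_i phi. *)
Definition cov_deriv (x : 'rV[R]_k) (i j : 'I_k) : 'rV[R]_n :=
  pderiv i (pderiv j phi) x +
  \row_(a < n) \sum_(b < n) \sum_(c < n)
    christoffel (phi x) a b c * pderiv i phi x 0 b * pderiv j phi x 0 c.

Definition first_form (x : 'rV[R]_k) : 'M[R]_k :=
  'J phi x *m G (phi x) *m ('J phi x)^T.

(* The G-orthogonal projection along the row space of 'J phi x, which is the
   tangent space of the immersed submanifold. *)
Definition normal_part (x : 'rV[R]_k) (w : 'rV[R]_n) : 'rV[R]_n :=
  w - w *m G (phi x) *m ('J phi x)^T *m invmx (first_form x) *m 'J phi x.

Definition second_form (x : 'rV[R]_k) (i j : 'I_k) : 'rV[R]_n :=
  normal_part x (cov_deriv x i j).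

(* The trace of the second fundamental form, without the factor 1 / k. *)
Definition mean_curvature (x : 'rV[R]_k) : 'rV[R]_n :=
  \sum_(i < k) \sum_(j < k) invmx (first_form x) i j *: second_form x i j.

End coordinates.

Definition minimal_immersion k n (S : manifold R k) (M : manifold R n)
    (g : tensor M) (f : S -> M) : Prop :=
  immersion f /\
  forall a b p, dom a p -> dom b (f p) ->
    mean_curvature (g b) (local_rep f a b) (coord a p) = 0.

(* g : R -> tensor F stands for the family (g_t) with t in I, and similarly for
   beta; their values outside the open interval I are irrelevant. *)
Section families.
Variables (I : set R) (oI : open I) (m : nat) (F : manifold R m).

Definition smooth_family (g : R -> tensor F) : Prop :=
  forall a : chart F, smooth_on (I `*` (coord a @` dom a))
    (fun z : R * 'rV[R]_m => g z.1 a z.2).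

(* beta dt^2 + g_t; the frame of the chart (_, a) of I x F is that of I followed
   by that of a. *)
Definition sum_metric (beta : R -> R) (g : R -> tensor F) :
    tensor (prod_manifold oI F) :=
  fun a y => let t := lsubmx y 0 0 in
    block_mx (beta t)%:M 0 0 (g t a.2 (rsubmx y)).

Definition dt_family (g : R -> tensor F) (t : R) : tensor F :=
  fun a y => derive1 (fun s => g s a y) t.

(* Tangent vectors X to F are ranged over by their components v in a chart. *)
Definition non_shrinking (beta : R -> R) (g : R -> tensor F) : Prop :=
  (forall t, I t -> 0 <= derive1 beta t) /\
  (forall t a p v, I t -> dom a p -> 0 <= qform (dt_family g t a (coord a p)) v).

Definition non_expanding (beta : R -> R) (g : R -> tensor F) : Prop :=
  (forall t, I t -> derive1 beta t <= 0) /\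
  (forall t a p v, I t -> dom a p -> qform (dt_family g t a (coord a p)) v <= 0).

Definition monotone_metric (beta : R -> R) (g : R -> tensor F) : Prop :=
  non_shrinking beta g \/ non_expanding beta g.

End families.
End riemannian.

(* Main.v *)
From HB Require Import structures.
From mathcomp Require Import all_boot all_order all_algebra.
From mathcomp Require Import all_classical all_reals all_analysis.
From mathcomp Require Import ring lra.
Require Import Defs.
Import Order.TTheory GRing.Theory Num.Theory.
Import numFieldNormedType.Exports.

Set Implicit Arguments.
Unset Strict Implicit.
Unset Printing Implicit Defensive.

Local Open Scope classical_set_scope.
Local Open Scope ring_scope.

(** Let tau be the height function t o f on S. In charts, the t-component of the
    equation H = 0 reads
      h^ij d_i d_j tau + b^l d_l tau = (1 / 2 beta) h^ij (d_t g)(d_i phi, d_j phi)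
    where h is the induced metric, phi is the F-component of f, and all terms
    involving d tau, including the one in beta', are absorbed into the
    continuous drift b. The right-hand side has the sign given by monotonicity,
    so Hopf's strong maximum principle makes the set where tau attains its
    maximum (its minimum in the non-expanding case) open; S being compact and
    connected, tau is constant. In a slice the F-components of H are those of the
    mean curvature of phi in (F, g_t0). *)

(** * Matrices *)

(** The inverse induced metric is used only through a factorisation [Q^T *m Q]. A contraction with
    h^ij then becomes a sum of values of a quadratic form on the rows of [Q]: the sign of d_t g
    passes to the right-hand side, and the second-order part at a maximum is a sum of second
    derivatives along lines, so no eigenvalues are needed. The drift exists for two reasons. The
    tangential part removed from the covariant derivative is a combination of the d_l f, so its
    t-component is linear in d tau. The beta' term is (beta' / 2 beta) |d tau|^2, and one of its two
    factors is frozen into the coefficient. The drift thus depends on f itself, but its continuity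
    suffices, since the barrier has to be a strict subsolution only near one point. That point is a
    maximum point nearest to a non-maximal one, hence on a Euclidean sphere with no maximum points
    inside. A quadratic barrier replaces Hopf's exponential: its restriction to a line is exactly a
    polynomial of degree two. A factor [s], equal to 1 or -1, treats maxima and minima of tau
    together. *)

Lemma spd_congr1 (R : rcfType) n (A : 'M[R]_n) :
  A^T = A -> (forall v : 'rV[R]_n, v != 0 -> 0 < (v *m A *m v^T) 0 0) ->
  exists Q : 'M[R]_n, Q *m A *m Q^T = 1%:M.
Proof.
elim: n A => [|n IH] A symA posA.
  by exists 1%:M; apply/matrixP => -[].
pose A' : 'M[R]_(1 + n) := A.
pose a := A 0 0; pose b : 'rV[R]_n := ursubmx A'; pose D : 'M[R]_n := drsubmx A'.
have eA : A' = block_mx a%:M b b^T D.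
  rewrite -[LHS]submxK; congr block_mx.
    by rewrite [LHS]mx11_scalar !mxE; congr ((A _ _)%:M); exact/val_inj.
  by rewrite trmx_ursub (_ : A'^T = A').
have a_gt0 : 0 < a.
  have : 0 < ((delta_mx 0 0 : 'rV[R]_n.+1) *m A *m (delta_mx 0 0 : 'rV[R]_n.+1)^T) 0 0.
    apply: posA; apply/eqP => /matrixP/(_ 0 0); rewrite !mxE !eqxx /=.
    by move/eqP; rewrite oner_eq0.
  by rewrite -rowE trmx_delta -colE !mxE.
(* One step of symmetric Gaussian elimination: [E] clears the off-diagonal blocks and leaves the
   Schur complement [D'], which inherits symmetry and positivity. *)
pose E : 'M[R]_(1 + n) := block_mx 1%:M 0 (- a^-1 *: b^T) 1%:M.
pose D' : 'M[R]_n := D - a^-1 *: (b^T *m b).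
have eE : E *m A' *m E^T = block_mx a%:M 0 0 D'.
  rewrite eA /E tr_block_mx !mulmx_block !trmx0 !trmx1 !linearZ /= trmxK.
  rewrite !mul1mx !mulmx1 !mul0mx !mulmx0 !addr0 !mul_scalar_mx -!scalemxAl.
  have a0 : a != 0 by rewrite gt_eqF.
  rewrite mul_mx_scalar !scalerA mulNr mulVf// !scaleN1r !addNr mul0mx scaler0 add0r.
  by rewrite scaleNr addrC.
have symD : D'^T = D'.
  rewrite /D' linearB /= linearZ /= trmx_mul trmxK; congr (_ - _).
  by rewrite trmx_drsub (_ : A'^T = A').
have posD (v : 'rV[R]_n) : v != 0 -> 0 < (v *m D' *m v^T) 0 0.
  move=> v0; pose w : 'rV[R]_(1 + n) := row_mx 0 v *m E.
  have -> : v *m D' *m v^T = w *m A' *m w^T.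
    rewrite /w trmx_mul !mulmxA -(mulmxA (row_mx 0 v)) -(mulmxA (row_mx 0 v)) eE.
    rewrite mul_row_block !mul0mx !mulmx0 !add0r tr_row_mx mul_row_col.
    by rewrite mul0mx add0r.
  apply: posA; apply: contra_neq v0.
  rewrite /w mul_row_block mul0mx mulmx1 mulmx0 !add0r => /(congr1 (@rsubmx _ 1 1 n)).
  by rewrite row_mxKr => ->; rewrite linear0.
have [Q' eQ'] := IH _ symD posD.
pose s := Num.sqrt a.
have ss : s * s = a by rewrite -expr2 sqr_sqrtr// ltW.
have s0 : s != 0 by rewrite gt_eqF// sqrtr_gt0.
pose P : 'M[R]_(1 + n) := block_mx s^-1%:M 0 0 Q'.
suff eP : P *m (E *m A' *m E^T) *m P^T = 1%:M.
  by exists (P *m E); rewrite trmx_mul !mulmxA; rewrite !mulmxA in eP.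
rewrite eE tr_block_mx !trmx0 tr_scalar_mx !mulmx_block !mul0mx !mulmx0 !addr0 !add0r.
rewrite !mul0mx eQ' -!scalar_mxM -ss mulrA mulVf// mul1r divff//.
by rewrite -scalar_mx_block.
Qed.

Lemma spd_unitmx (R : realFieldType) n (A : 'M[R]_n) :
  (forall v : 'rV[R]_n, v != 0 -> 0 < (v *m A *m v^T) 0 0) -> A \in unitmx.
Proof.
move=> posA; rewrite -row_free_unit; apply: inj_row_free => v vA.
by apply/eqP/contraT => /posA; rewrite vA mul0mx mxE ltxx.
Qed.

(** Inverting [Q *m A *m Q^T = 1%:M] gives the factorisation. Applied to the first fundamental form,
    it encodes ellipticity. *)
Lemma spd_invmx (R : rcfType) n (A : 'M[R]_n) :
  A^T = A -> (forall v : 'rV[R]_n, v != 0 -> 0 < (v *m A *m v^T) 0 0) ->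
  exists2 Q : 'M[R]_n, Q \in unitmx & invmx A = Q^T *m Q.
Proof.
move=> symA posA; have [Q eQ] := spd_congr1 symA posA.
have uA := spd_unitmx posA.
move: (eQ); rewrite -mulmxA => /mulmx1_unit [uQ _].
exists Q => //.
have {}eQ : A *m (Q^T *m Q) = 1%:M.
  apply: (can_inj (mulKmx uQ)); rewrite mulmx1 !mulmxA eQ.
  by rewrite mul1mx.
by rewrite -[LHS]mulmx1 -eQ mulKmx.
Qed.

Section contraction.
Context {R : comNzRingType} {n : nat}.
Implicit Types A B Q : 'M[R]_n.

Definition frob A B : R := \sum_i \sum_j A i j * B i j.

Lemma frobE A B : frob A B = \tr (A *m B^T).
Proof.
rewrite /frob /mxtrace; apply: eq_bigr => i _; rewrite mxE.
by apply: eq_bigr => j _; rewrite mxE.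
Qed.

(** This is how a sign of the form [B] is transferred to its trace against a positive matrix. *)
Lemma frob_gram Q B :
  frob (Q^T *m Q) B = \sum_l (row l Q *m B *m (row l Q)^T) 0 0.
Proof.
rewrite frobE -mulmxA mxtrace_mulC -mxtrace_tr !trmx_mul !trmxK mulmxA /mxtrace.
apply: eq_bigr => l _; rewrite -row_mul.
by rewrite !mxE; apply: eq_bigr => j _; rewrite !mxE.
Qed.

Lemma frobZr A c B : frob A (c *: B) = c * frob A B.
Proof. by rewrite !frobE linearZ -scalemxAr mxtraceZ. Qed.

End contraction.

(** * Limits of matrix operations *)

Section matrix_limits.
Context {R : realType} {T : Type} (F : set_system T) {FF : Filter F}.

Lemma cvg_entry m n (f : T -> 'M[R]_(m, n)) (M : 'M[R]_(m, n)) i j :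
  f @ F --> M -> (fun x => f x i j) @ F --> M i j.
Proof. by move=> fM; apply: cvg_comp fM (@coord_continuous _ _ _ i j M). Qed.

Lemma cvg_sumr (W : normedModType R) (J : Type) (r : seq J) (P : pred J)
    (f : J -> T -> W) (a : J -> W) :
  (forall j, P j -> f j @ F --> a j) ->
  (fun x => \sum_(j <- r | P j) f j x) @ F --> \sum_(j <- r | P j) a j.
Proof. by move=> fa; apply: cvg_big => //; exact: add_continuous. Qed.

Lemma cvg_prodr (J : Type) (r : seq J) (P : pred J) (f : J -> T -> R) (a : J -> R) :
  (forall j, P j -> f j @ F --> a j) ->
  (fun x => \prod_(j <- r | P j) f j x) @ F --> \prod_(j <- r | P j) a j.
Proof. by move=> fa; apply: cvg_big => //; exact: mul_continuous. Qed.

Lemma cvg_mulmx m n p (f : T -> 'M[R]_(m, n)) (g : T -> 'M[R]_(n, p))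
    (M : 'M[R]_(m, n)) (N : 'M[R]_(n, p)) :
  f @ F --> M -> g @ F --> N -> (fun x => f x *m g x) @ F --> M *m N.
Proof.
move=> fM gN; apply: cvg_mx => i j; rewrite mxE; under eq_fun do rewrite mxE.
by apply: cvg_sumr => l _; apply: cvgM; exact: cvg_entry.
Qed.

Lemma cvg_trmx m n (f : T -> 'M[R]_(m, n)) (M : 'M[R]_(m, n)) :
  f @ F --> M -> (fun x => (f x)^T) @ F --> M^T.
Proof.
move=> fM; apply: cvg_mx => i j; rewrite mxE; under eq_fun do rewrite mxE.
exact: cvg_entry.
Qed.

Lemma cvg_det n (f : T -> 'M[R]_n) (M : 'M[R]_n) :
  f @ F --> M -> (fun x => \det (f x)) @ F --> \det M.
Proof.
move=> fM; apply: cvg_sumr => s _; apply: cvgM; first exact: cvg_cst.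
by apply: cvg_prodr => i _; exact: cvg_entry.
Qed.

Lemma cvg_adj n (f : T -> 'M[R]_n) (M : 'M[R]_n) :
  f @ F --> M -> (fun x => \adj (f x)) @ F --> \adj M.
Proof.
move=> fM; apply: cvg_mx => i j; rewrite mxE; under eq_fun do rewrite mxE.
apply: cvgM; first exact: cvg_cst.
apply: cvg_det; apply: cvg_mx => a b; rewrite !mxE; under eq_fun do rewrite !mxE.
exact: cvg_entry.
Qed.

Lemma cvg_invmx n (f : T -> 'M[R]_n) (M : 'M[R]_n) : M \in unitmx ->
  f @ F --> M -> (fun x => invmx (f x)) @ F --> invmx M.
Proof.
move=> uM fM; have dM : \det M != 0 by rewrite -unitfE -unitmxE.
have dfM := cvg_det fM.
rewrite (_ : invmx M = (\det M)^-1 *: \adj M); last by rewrite /invmx uM.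
have : (fun x => (\det (f x))^-1 *: \adj (f x)) @ F --> (\det M)^-1 *: \adj M.
  by apply: cvgZ; [exact: cvgV|exact: cvg_adj].
(* [invmx] is given by the adjugate formula only at invertible matrices, so the formula is used
   where the determinant stays away from 0. *)
apply: cvg_trans; apply: near_eq_cvg.
apply: filterS (cvgr_neq0 _ dfM dM) => x d0.
by rewrite /invmx unitmxE unitfE d0.
Qed.

End matrix_limits.

(** * Second derivative test *)

Lemma is_derive_line (R : realType) (V W : normedModType R) (u : V -> W)
    (z d : V) (r : R) : derivable u (r *: d + z) d ->
  is_derive r 1 (fun s => u (s *: d + z)) ('D_d u (r *: d + z)).
Proof.
move=> du; have E :
    (fun h : R => h^-1 *: (u ((h *: (1 : R^o) + r) *: d + z) - u (r *: d + z))) =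
    (fun h : R => h^-1 *: (u (h *: d + (r *: d + z)) - u (r *: d + z))).
  by apply/funext => h; rewrite scalerDl [h *: 1]mulr1 addrA.
by split; rewrite /derivable /derive /= E.
Qed.

Lemma second_derivative_test (R : realType) (phi psi : R -> R) (c : R) :
  (\forall r \near (0 : R), is_derive (r : R) 1 phi (psi r)) -> is_derive (0 : R) 1 psi c ->
  (\forall r \near (0 : R), phi r <= phi 0) -> psi 0 = 0 /\ c <= 0.
Proof.
move=> dphi dpsi max0.
have [e /= e0 H] : exists2 e : R, 0 < e & forall r, `|r| < e ->
    is_derive (r : R) 1 phi (psi r) /\ phi r <= phi 0.
  have /nbhs_ballP[e e0 eH] :
      \forall r \near (0 : R), is_derive (r : R) 1 phi (psi r) /\ phi r <= phi 0.
    by near=> r; split; near: r.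
  exists e => // r re.
    by apply: eH; rewrite /ball /= sub0r normrN.
have psi0 : psi 0 = 0.
  have [d0 _] := H 0 (ltac:(by rewrite normr0)).
  rewrite -(@derive_val _ _ _ _ _ _ _ d0).
  have : is_derive (0 : R) 1 phi 0.
    apply: (@derive1_at_max _ phi (- e) e).
    - by rewrite (@le_trans _ _ 0) ?oppr_le0 ?ltW.
    - by move=> r /itvP re; have [] := H r (ltac:(by rewrite ltr_norml !re)).
    - by rewrite in_itv/= oppr_lt0 e0.
    - by move=> r /itvP re; have [] := H r (ltac:(by rewrite ltr_norml !re)).
  by move=> d0'; rewrite derive_val.
split => //; rewrite leNgt; apply/negP => c0.
(* Since [psi] vanishes at 0, a positive derivative there makes it positive just to the right; the
   mean value theorem then lifts [phi] above its maximum. *)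
have [d /= d0 dP] : exists2 d : R, 0 < d & forall r, 0 < r < d -> 0 < psi r.
  have : (fun h : R => h^-1 *: (psi (h *: (1 : R^o) + 0) - psi 0)) @ 0^' --> c.
    by have [dp <-] := dpsi; exact: dp.
  move=> /(cvgr_gt c)/(_ _ c0).
  move=> /nbhs_ballP[d d0 dP]; exists d => // r /andP[r0 rd].
  have := dP r; rewrite /ball /= sub0r normrN gtr0_norm// => /(_ rd (lt0r_neq0 r0)).
  by rewrite psi0 subr0 addr0 [r *: _]mulr1 pmulr_rgt0 ?invr_gt0.
pose r := Num.min e d / 2.
have m0 : 0 < Num.min e d by rewrite lt_min e0.
have r0 : 0 < r by rewrite divr_gt0.
have rm : r < Num.min e d by rewrite ltr_pdivrMr// ltr_pMr// ltr1n.
have [re rd] : r < e /\ r < d by move: rm; rewrite lt_min => /andP.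
have [||x /itvP xr E] := @MVT _ phi psi 0 r r0.
- by move=> x /itvP xr; apply: (H x _).1; rewrite gtr0_norm ?xr// (lt_trans _ re)// xr.
- apply: derivable_within_continuous => x /itvP xr.
  by have [[]] := H x (ltac:(by rewrite ger0_norm ?xr// (le_lt_trans _ re)// xr)).
have : 0 < phi r - phi 0.
  rewrite E subr0 mulr_gt0//; apply: dP; rewrite xr/=.
  by rewrite (lt_trans _ rd)// xr.
by rewrite subr_gt0 ltNge (H r _).2// gtr0_norm.
Unshelve. all: by end_near. Qed.

(** The perturbation of [u] enters only through its coefficients [al] and [ga] on the line, so the
    barrier never has to be differentiated. *)
Lemma directional_second_derivative_test (R : realType) (V : normedModType R)
    (u : V -> R) (z d : V) (al ga : R) :
  (\forall x \near z, derivable u x d) -> derivable ('D_d u) z d ->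
  (\forall r \near (0 : R), u (r *: d + z) + (r * al + r ^+ 2 * ga) <= u z) ->
  'D_d u z = - al /\ 'D_d ('D_d u) z <= - (2 * ga).
Proof.
move=> du ddu zmax.
have czd : {for (0 : R), continuous (fun r : R => r *: d + z)}.
  by apply: cvgD; [exact: scalel_continuous|exact: cvg_cst].
have E0 : 0 *: d + z = z by rewrite scale0r add0r.
have du0 : \forall r \near (0 : R), derivable u (r *: d + z) d.
  by apply: (czd (fun x => derivable u x d)); rewrite /= E0.
pose phi r := u (r *: d + z) + (r * al + r ^+ 2 * ga).
pose psi r := 'D_d u (r *: d + z) + (al + 2 * r * ga).
have [|||] := @second_derivative_test _ phi psi ('D_d ('D_d u) z + 2 * ga).
- apply: filterS du0 => r dur.
  have dr := is_derive_line dur.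
  rewrite /phi /psi; apply: is_derive_eq.
  by rewrite /GRing.scale /=; ring.
- have dr : is_derive (0 : R) 1 (fun r : R => 'D_d u (r *: d + z)) ('D_d ('D_d u) z).
    by rewrite -[X in 'D_d _ X]E0; apply: is_derive_line; rewrite E0.
  rewrite /psi; apply: is_derive_eq.
  by rewrite /GRing.scale /=; ring.
- apply: filterS zmax => r; rewrite /phi E0 mul0r expr0n /= mul0r !addr0.
  exact.
rewrite /psi E0 => psi0 c0; split; lra.
Qed.

(** * Barrier *)

Section coordinate_derivatives.
Context {R : realType} {k : nat}.

Lemma derive_pderiv (W : normedModType R) (f : 'rV[R]_k -> W) (v x : 'rV[R]_k) :
  differentiable f x -> 'D_v f x = \sum_i v 0 i *: pderiv i f x.
Proof.
move=> df; rewrite deriveE// {1}(row_sum_delta v) linear_sum /=.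
by apply: eq_bigr => i _; rewrite linearZ /= /pderiv deriveE.
Qed.

Lemma jacobianE n (f : 'rV[R]_k -> 'rV[R]_n) (x : 'rV[R]_k) i :
  differentiable f x -> row i ('J f x) = pderiv i f x.
Proof. by move=> df; rewrite rowE -deriveEjacobian. Qed.

Definition hessian (u : 'rV[R]_k -> R) (x : 'rV[R]_k) : 'M[R]_k :=
  \matrix_(i, j) pderiv i (pderiv j u) x.

Lemma derive2_hessian (u : 'rV[R]_k -> R) (v x : 'rV[R]_k) :
  (\forall y \near x, differentiable u y) ->
  (forall j, differentiable (pderiv j u) x) ->
  derivable ('D_v u) x v /\
  'D_v ('D_v u) x = (v *m hessian u x *m v^T) 0 0.
Proof.
(* Differentiability on a whole neighbourhood is what allows ['D_v u] to be replaced by this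
   combination before the second derivative is taken. *)
move=> du ddu; pose w := \sum_j (v 0 j *: pderiv j u).
have uw : \forall y \near x, w y = 'D_v u y.
  apply: filterS du => y duy; rewrite derive_pderiv// /w.
  by rewrite fct_sumE; apply: eq_bigr.
have dw : is_derive x v w (\sum_j v 0 j *: 'D_v (pderiv j u) x).
  apply: is_derive_sum => j; apply: is_deriveZ; apply: derivableP.
  exact: diff_derivable.
split; first by apply: (@near_eq_derivable _ _ _ w).
rewrite -(near_eq_derive v uw) derive_val mxE; apply: eq_bigr => j _.
rewrite derive_pderiv// mulrC !mxE; congr (_ * _); apply: eq_bigr => i _.
by rewrite mxE.
Qed.

End coordinate_derivatives.

Section dot_product.
Context {R : realFieldType} {k : nat}.
Implicit Types v w x : 'rV[R]_k.

Definition dot v w : R := (v *m w^T) 0 0.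

Lemma dotE v w : dot v w = \sum_i v 0 i * w 0 i.
Proof. by rewrite /dot mxE; apply: eq_bigr => i _; rewrite mxE. Qed.

Lemma dotC v w : dot v w = dot w v.
Proof. by rewrite !dotE; apply: eq_bigr => i _; rewrite mulrC. Qed.

Lemma dotDl v w x : dot (v + w) x = dot v x + dot w x.
Proof. by rewrite /dot mulmxDl mxE. Qed.

Lemma dotDr v w x : dot x (v + w) = dot x v + dot x w.
Proof. by rewrite dotC dotDl !(dotC x). Qed.

Lemma dotZl c v x : dot (c *: v) x = c * dot v x.
Proof. by rewrite /dot -scalemxAl mxE. Qed.

Lemma dotZr c v x : dot x (c *: v) = c * dot x v.
Proof. by rewrite dotC dotZl dotC. Qed.

Lemma dot0l v : dot 0 v = 0.
Proof. by rewrite /dot mul0mx mxE. Qed.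

Lemma dot0r v : dot v 0 = 0.
Proof. by rewrite dotC dot0l. Qed.

Lemma dotvv_ge0 v : 0 <= dot v v.
Proof. by rewrite dotE sumr_ge0// => i _; rewrite -expr2 sqr_ge0. Qed.

Lemma dotvv_gt0 v : v != 0 -> 0 < dot v v.
Proof.
move=> v0; rewrite lt_neqAle dotvv_ge0 andbT eq_sym; apply: contra_neq v0.
rewrite dotE => /psumr_eq0P v0; apply/rowP => i; rewrite mxE.
by apply/eqP; rewrite -sqrf_eq0 expr2 v0// => j _; rewrite -expr2 sqr_ge0.
Qed.

End dot_product.

Section barrier.
Context {R : realType} {k : nat}.
Variables (A : R) (nu p : 'rV[R]_k).

(* Where the barrier is nonnegative near p, x lies in the ball centered at
   p - nu whose boundary passes through p; a large A makes the Hessian of the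
   quadratic term dominate the other second-order and drift terms at p. *)
Definition barrier (x : 'rV[R]_k) : R :=
  - dot (x - p) nu + A * dot (x - p) nu ^+ 2 - 2 * dot (x - p) (x - p).

(** The derivative of [barrier] at [x] along [d], in closed form; [barrier_line] recovers it as the
    linear coefficient. *)
Definition barrier_slope (x d : 'rV[R]_k) : R :=
  - dot d nu + 2 * A * dot (x - p) nu * dot d nu - 4 * dot d (x - p).

Lemma barrier_line (x d : 'rV[R]_k) (r : R) :
  barrier (r *: d + x) = barrier x + (r * barrier_slope x d +
    r ^+ 2 * (A * dot d nu ^+ 2 - 2 * dot d d)).
Proof.
rewrite /barrier /barrier_slope -(addrA (r *: d)); move: (x - p) => y.
by rewrite !(dotDl, dotDr, dotZl, dotZr) (dotC y d); ring.
Qed.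

(** Write y for [dot (x - p) nu] and N for the squared distance to [p]. The bound gives A y^2 <=
    |y|, so a nonnegative barrier forces y < 0 and then 2 N <= -2 y. The factor 2 in the barrier
    thus leaves N + 2 y <= y < 0, which says that [x] is strictly inside the ball about [p - nu]. *)
Lemma barrier_ge0 (x : 'rV[R]_k) : `|A * dot (x - p) nu| <= 1 -> x != p ->
  0 <= barrier x -> dot (x - p) (x - p) + 2 * dot (x - p) nu < 0.
Proof.
move=> Ay xp; rewrite /barrier; have := @dotvv_gt0 _ _ (x - p).
rewrite subr_eq0 => /(_ xp); move: (dot (x - p) (x - p)) (dot (x - p) nu) Ay.
move=> N y; rewrite ler_norml => /andP[Ay1 Ay2] N0 v0; nra.
Qed.

Lemma cvg_dot (T : Type) (F : set_system T) {FF : Filter F}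
    (f g : T -> 'rV[R]_k) (v w : 'rV[R]_k) :
  f @ F --> v -> g @ F --> w -> (fun x => dot (f x) (g x)) @ F --> dot v w.
Proof.
move=> fv gw; apply: (@cvg_entry _ _ _ _ _ (fun x => f x *m (g x)^T) (v *m w^T)).
by apply: cvg_mulmx => //; apply: cvg_trmx.
Qed.

Section limits.
Context {T : Type} {F : set_system T} {FF : Filter F} (f : T -> 'rV[R]_k).
Variables (x : 'rV[R]_k) (fx : f @ F --> x).

Let cvg_center : (fun t => f t - p) @ F --> x - p.
Proof. by apply: cvgB => //; exact: cvg_cst. Qed.

Let cvg_height : (fun t => dot (f t - p) nu) @ F --> dot (x - p) nu.
Proof. by apply: cvg_dot => //; exact: cvg_cst. Qed.

Lemma cvg_barrier : (fun t => barrier (f t)) @ F --> barrier x.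
Proof.
apply: cvgB; last by apply: cvgM; [exact: cvg_cst|exact: cvg_dot].
apply: cvgD; first exact: cvgN.
by apply: cvgM; [exact: cvg_cst|exact: cvgM].
Qed.

Lemma cvg_barrier_slope (d : 'rV[R]_k) :
  (fun t => barrier_slope (f t) d) @ F --> barrier_slope x d.
Proof.
apply: cvgB; last first.
  by apply: cvgM; [exact: cvg_cst|apply: cvg_dot => //; exact: cvg_cst].
apply: cvgD; first exact: cvg_cst.
apply: cvgM; last exact: cvg_cst.
by apply: cvgM => //; exact: cvg_cst.
Qed.

End limits.

End barrier.

(** * The elliptic operator and the barrier *)

Section hopf.
Context {R : realType} {k : nat}.
Implicit Types (u : 'rV[R]_k -> R) (p z nu : 'rV[R]_k).

Definition elliptic (a : 'M[R]_k) (b : 'rV[R]_k) u z : R :=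
  frob a (hessian u z) + \sum_l b 0 l * pderiv l u z.

(** The operator [elliptic] applied to the barrier at [z], with the constant Hessian 2 (A nu^T nu -
    2 Id) and the gradient written out. *)
Definition elliptic_barrier (A : R) nu p (a : 'M[R]_k) (b z : 'rV[R]_k) : R :=
  2 * (A * frob a (nu^T *m nu) - 2 * frob a 1%:M) +
  \sum_l b 0 l * barrier_slope A nu p z (delta_mx 0 l).

Definition twice_differentiable u z :=
  (\forall y \near z, differentiable u y) /\
  forall j, differentiable (pderiv j u) z.

Lemma frob_gram_dot (Q : 'M[R]_k) nu :
  frob (Q^T *m Q) (nu^T *m nu) = \sum_l dot (row l Q) nu ^+ 2.
Proof.
rewrite frob_gram; apply: eq_bigr => l _.
by rewrite mulmxA -(mulmxA _ nu) mxE big_ord1 expr2 [X in _ * X]dotC.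
Qed.

(** The second-order part is tested along the rows of [Q], the drift along the coordinate
    directions. First derivatives at the maximum satisfy an equality, so the sign of [b] is
    immaterial. *)
Lemma elliptic_at_max u A nu p z (e : R) (Q : 'M[R]_k) (b : 'rV[R]_k) :
  twice_differentiable u z ->
  (\forall y \near z, u y + e * barrier A nu p y <= u z + e * barrier A nu p z) ->
  elliptic (Q^T *m Q) b u z <= - (e * elliptic_barrier A nu p (Q^T *m Q) b z).
Proof.
move=> [du ddu] zmax.
have test d : 'D_d u z = - (e * barrier_slope A nu p z d) /\
    (d *m hessian u z *m d^T) 0 0 <= - (2 * (e * (A * dot d nu ^+ 2 - 2 * dot d d))).
  have [ddd <-] := derive2_hessian d du ddu.
  apply: directional_second_derivative_test => //.
    by apply: filterS du => y; exact: diff_derivable.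
  have czd : (fun r : R => r *: d + z) @ (0 : R) --> z.
    rewrite -[X in _ --> X]add0r -(scale0r d).
    by apply: cvgD; [exact: scalel_continuous|exact: cvg_cst].
  have : \forall r \near (0 : R), u (r *: d + z) + e * barrier A nu p (r *: d + z) <=
      u z + e * barrier A nu p z := czd _ zmax.
  apply: filterS => r /=.
  by rewrite barrier_line; lra.
rewrite /elliptic /elliptic_barrier mulrDr opprD; apply: lerD; last first.
  rewrite mulr_sumr -sumrN; apply: ler_sum => l _.
  by rewrite /pderiv (test _).1 mulrN mulrCA.
rewrite frob_gram_dot.
have -> : frob (Q^T *m Q) 1%:M = \sum_l dot (row l Q) (row l Q).
  by rewrite frob_gram; apply: eq_bigr => l _; rewrite mulmx1.
rewrite frob_gram !mulr_sumr -sumrB !mulr_sumr -sumrN.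
apply: ler_sum => l _; apply: le_trans (test _).2 _.
by rewrite le_eqVlt; apply/orP; left; apply/eqP; ring.
Qed.

Lemma cvg_frob (T : Type) (F : set_system T) {FF : Filter F}
    (a : T -> 'M[R]_k) (a0 B : 'M[R]_k) :
  a @ F --> a0 -> (fun t => frob (a t) B) @ F --> frob a0 B.
Proof.
move=> aa0; apply: cvg_sumr => i _; apply: cvg_sumr => j _.
by apply: cvgM; [exact: cvg_entry|exact: cvg_cst].
Qed.

Lemma cvg_elliptic_barrier (T : Type) (F : set_system T) {FF : Filter F} A nu p
    (a : T -> 'M[R]_k) (b z : T -> 'rV[R]_k) (a0 : 'M[R]_k) (b0 z0 : 'rV[R]_k) :
  a @ F --> a0 -> b @ F --> b0 -> z @ F --> z0 ->
  (fun t => elliptic_barrier A nu p (a t) (b t) (z t)) @ F -->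
  elliptic_barrier A nu p a0 b0 z0.
Proof.
move=> aa0 bb0 zz0; apply: cvgD.
  apply: cvgM; first exact: cvg_cst.
  by apply: cvgB; apply: cvgM; solve [exact: cvg_cst|exact: cvg_frob].
apply: cvg_sumr => l _; apply: cvgM; first exact: cvg_entry.
exact: cvg_barrier_slope.
Qed.

End hopf.

(** * Strong maximum principle *)

Section strong_maximum_principle.
Context {R : realType} {k : nat}.
Variables (U : set 'rV[R]_k) (u : 'rV[R]_k -> R).
Variables (a : 'rV[R]_k -> 'M[R]_k) (b : 'rV[R]_k -> 'rV[R]_k) (M : R).
Hypotheses (oU : open U) (u_smooth : smooth_on U u).
Hypothesis (ca : forall x, U x -> {for x, continuous a}).
Hypothesis (cb : forall x, U x -> {for x, continuous b}).
Hypothesis (a_gram : forall x, U x -> exists2 Q, Q \in unitmx & a x = Q^T *m Q).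
Hypothesis (Lu : forall x, U x -> 0 <= elliptic (a x) (b x) u x).
Hypothesis (uM : forall x, U x -> u x <= M).

Let u_diff x : U x -> differentiable u x.
Proof. exact: (u_smooth [::]). Qed.

Let u_diff2 x : U x -> twice_differentiable u x.
Proof.
move=> Ux; split; last by move=> j; exact: (u_smooth [:: delta_mx 0 j]).
by apply: filterS (open_nbhs_nbhs (conj oU Ux)) => y; exact: u_diff.
Qed.

Let cu x : U x -> {for x, continuous u}.
Proof. by move=> /u_diff; exact: differentiable_continuous. Qed.

Lemma cvg_center (p x : 'rV[R]_k) : (fun y => y - p) @ x --> x - p.
Proof. by apply: (@cvgB _ _ _ (nbhs x)); [move=> ?|exact: cvg_cst]. Qed.

Lemma cvg_dist_center (p x : 'rV[R]_k) : (fun y => `|y - p|) @ x --> `|x - p|.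
Proof. exact: (cvg_norm (@cvg_center p x)). Qed.

Lemma compact_closed_ball_rV (p : 'rV[R]_k) (r : R) :
  compact [set x : 'rV[R]_k | `|x - p| <= r].
Proof.
apply: bounded_closed_compact.
  exists (r + `|p|); split; first exact: num_real.
  move=> y ry x /= xp; apply: le_trans (ltW ry).
  by rewrite -[x in `|x|](subrK p) (le_trans (ler_normD _ _))// lerD2r.
apply: (@closed_comp _ _ (fun x : 'rV[R]_k => `|x - p|) [set y | y <= r]).
  by move=> x _; exact: cvg_dist_center.
exact: closed_le.
Qed.

(** At [p] itself the quantity is affine in A, equal to 2 A c + s. Here c is the squared length of
    [nu *m Q^T], positive because [Q] is invertible. The chosen A makes it |s| + 1 + s >= 1. *)
Let barrier_subsolution nu p : U p -> nu != 0 ->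
  exists A, 0 < elliptic_barrier A nu p (a p) (b p) p.
Proof.
move=> Up nu0; have [Q uQ aQ] := a_gram Up.
pose c := frob (a p) (nu^T *m nu).
have c0 : 0 < c.
  rewrite /c aQ frob_gram_dot (_ : \sum_l _ = dot (nu *m Q^T) (nu *m Q^T)).
    apply: dotvv_gt0; apply: contra_neq nu0 => /(congr1 (mulmx ^~ (invmx Q^T))).
    by rewrite mul0mx mulmxK// unitmx_tr.
  rewrite dotE; apply: eq_bigr => l _; rewrite expr2.
  suff -> : (nu *m Q^T) 0 l = dot (row l Q) nu by [].
  by rewrite dotC dotE mxE; apply: eq_bigr => i _; rewrite !mxE.
pose s := - 4 * frob (a p) 1%:M - \sum_l b p 0 l * dot (delta_mx 0 l) nu.
exists ((`|s| + 1) / (2 * c)).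
rewrite /elliptic_barrier -/c.
have -> : \sum_l b p 0 l * barrier_slope ((`|s| + 1) / (2 * c)) nu p p (delta_mx 0 l)
    = - \sum_l b p 0 l * dot (delta_mx 0 l) nu.
  rewrite -sumrN; apply: eq_bigr => l _; rewrite /barrier_slope subrr.
  by rewrite dot0l dot0r !mulr0 mul0r subr0 addr0 mulrN.
have -> : 2 * ((`|s| + 1) / (2 * c) * c - 2 * frob (a p) 1%:M) -
    \sum_l b p 0 l * dot (delta_mx 0 l) nu = (`|s| + 1) + s.
  by rewrite /s; field; rewrite gt_eqF.
have := ler_norm (- s); rewrite normrN; lra.
Qed.

(** Geometrically, [p] is a maximum point on the sphere about [p - nu], and near [p] there are none
    inside. Adding a small multiple of the barrier produces an interior maximum, at which [Lu]
    contradicts the strict positivity of [elliptic_barrier]. *)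
Let no_touching nu p : U p -> u p = M -> nu != 0 ->
  (\forall x \near p, dot (x - p) (x - p) + 2 * dot (x - p) nu < 0 -> u x < M) ->
  False.
Proof.
move=> Up upM nu0 touch.
have [A Ap] := barrier_subsolution Up nu0.
have nearP : \forall x \near p, [/\ U x,
    0 < elliptic_barrier A nu p (a x) (b x) x, `|A * dot (x - p) nu| <= 1 &
    dot (x - p) (x - p) + 2 * dot (x - p) nu < 0 -> u x < M].
  have cy : (fun x => `|A * dot (x - p) nu|) @ p --> (0 : R).
    rewrite (_ : 0 = `|A * dot (p - p) nu|).
      exact: (cvg_norm (cvgM (cvg_cst A) (cvg_dot (@cvg_center p p) (cvg_cst nu)))).
    by rewrite subrr dot0l mulr0 normr0.
  have n1 : \forall x \near p, U x by exact: open_nbhs_nbhs.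
  have cL : (fun x => elliptic_barrier A nu p (a x) (b x) x) @ p -->
      elliptic_barrier A nu p (a p) (b p) p.
    exact: (@cvg_elliptic_barrier _ _ _ (nbhs p) _ A nu p a b id _ _ _ (ca Up) (cb Up)).
  have n2 : \forall x \near p, 0 < elliptic_barrier A nu p (a x) (b x) x.
    exact: (cvgr_gt _ cL _ Ap).
  have n3 : \forall x \near p, `|A * dot (x - p) nu| <= 1.
    exact: (cvgr_le _ cy _ (@ltr01 R)).
  have n5 : nbhs p (U `&` (fun x => `|A * dot (x - p) nu| <= 1) `&`
      ((fun x => 0 < elliptic_barrier A nu p (a x) (b x) x) `&`
      (fun x => dot (x - p) (x - p) + 2 * dot (x - p) nu < 0 -> u x < M))).
    by do 2 apply: filterI.
  by apply: (@filterS _ (nbhs p) _ _ _ _ n5) => x [[? ?] [? ?]].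
have [r r0 rP] : exists2 r : R, 0 < r & forall x, `|x - p| <= r -> [/\ U x,
    0 < elliptic_barrier A nu p (a x) (b x) x, `|A * dot (x - p) nu| <= 1 &
    dot (x - p) (x - p) + 2 * dot (x - p) nu < 0 -> u x < M].
  have /nbhs_ballP[e /= e0 eP] := nearP; exists (e / 2); first by rewrite divr_gt0.
  move=> x xp; apply: eP; rewrite mx_norm_ball /ball_ /= distrC (le_lt_trans xp)//.
  by rewrite ltr_pdivrMr// ltr_pMr// ltr1n.
pose K := [set x : 'rV[R]_k | `|x - p| <= r].
have cK : compact K := @compact_closed_ball_rV p r.
pose v := barrier A nu p.
have vp : v p = 0.
  by rewrite /v /barrier subrr !dot0l expr0n /= !mulr0 oppr0 !addr0.
have Kp : K p by rewrite /K /= subrr normr0 ltW.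
have cvK (f : 'rV[R]_k -> R) : (forall x, K x -> {for x, continuous f}) ->
    {within K, continuous f}.
  by move=> cf; apply: continuous_in_subspaceT => x /set_mem; exact: cf.
have cv x : {for x, continuous v}.
  exact: (@cvg_barrier _ _ A nu p _ (nbhs x) _ id x).
(* On the part of the boundary where the barrier is nonnegative, [barrier_ge0] places the point
   inside the touching ball, so u < M there; by compactness a uniform gap remains for a small
   multiple of [v]. *)
have [e e0 eP] : exists2 e : R, 0 < e & forall x, `|x - p| = r -> 0 <= v x ->
    u x + e * v x < M.
  pose C := [set x | `|x - p| = r] `&` [set x | 0 <= v x].
  have clC : closed C.
    apply: closedI.
      apply: (@closed_comp _ _ (fun x : 'rV[R]_k => `|x - p|) [set y | y = r]).
        by move=> x _; exact: cvg_dist_center.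
      exact: closed_eq.
    apply: (@closed_comp _ _ v [set y | 0 <= y]); last exact: closed_ge.
    by move=> x _; exact: cv.
  have CK : C `<=` K by move=> x [/= xr _]; rewrite /K /= xr.
  have cC : compact C by exact: subclosed_compact clC cK CK.
  have [C0|/set0P C0] := eqVneq C set0.
    by exists 1 => // x xr vx; have : C x by []; rewrite C0.
  have [x /set_mem Cx xmax] : exists2 x, x \in C & forall y, y \in C -> u y <= u x.
    apply: EVT_max_rV => //; apply: continuous_in_subspaceT => y /set_mem /CK Ky.
    by apply: cu; have [] := rP y Ky.
  have [y /set_mem Cy ymax] : exists2 y, y \in C & forall z, z \in C -> v z <= v y.
    by apply: EVT_max_rV => //; apply: continuous_in_subspaceT => y _; exact: cv.
  have uxM : u x < M.
    have [_ _ Ax] := rP x (CK x Cx); apply; apply: barrier_ge0 Ax _ Cx.2.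
    by rewrite -subr_eq0 -normr_gt0 Cx.1.
  have vy : 0 < 1 + v y by rewrite ltr_wpDr//; exact: Cy.2.
  (* The gap divided by more than the largest value of [v] on [C]; the added 1 gives strictness and
     keeps the denominator positive. *)
  exists ((M - u x) / (1 + v y)); first by rewrite divr_gt0// subr_gt0.
  move=> z zr vz; have Cz : z \in C by exact/mem_set.
  have vzy : v z / (1 + v y) < 1.
    by rewrite ltr_pdivrMr// mul1r (le_lt_trans (ymax z Cz))// ltrDr.
  have : (M - u x) * (v z / (1 + v y)) < M - u x by rewrite gtr_pMr// subr_gt0.
  by rewrite mulrA mulrAC; have := xmax z Cz; lra.
have cw x : K x -> {for x, continuous (fun x => u x + e * v x)}.
  move=> Kx; have cux : {for x, continuous u} by apply: cu; have [] := rP x Kx.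
  exact: (cvgD cux (cvgM (cvg_cst e) (cv x))).
have [z /set_mem Kz zmax] := EVT_max_rV (ex_intro _ p Kp) cK (cvK _ cw).
have wz : M <= u z + e * v z.
  by have := zmax p (mem_set Kp); rewrite vp mulr0 addr0 upM.
have [Uz Lz _ _] := rP z Kz.
(* On the boundary the perturbed function is below M: by the choice of [e] where v >= 0, and because
   u <= M where v < 0. It is at least M at [z], which is therefore interior. *)
have zr : `|z - p| < r.
  rewrite lt_neqAle Kz andbT; apply/eqP => zr.
  have [v0|v0] := leP 0 (v z); first by have := eP z zr v0; rewrite ltNge wz.
  have : e * v z < 0 by rewrite pmulr_rlt0.
  by have := uM Uz; lra.
have [Q _ aQ] := a_gram Uz.
have : elliptic (a z) (b z) u z <= - (e * elliptic_barrier A nu p (a z) (b z) z).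
  rewrite aQ; apply: elliptic_at_max; first exact: u_diff2.
  have : \forall y \near z, `|y - p| < r.
    have cn : (fun y => `|y - p|) @ z --> `|z - p|.
      by exact: cvg_dist_center.
    exact: cvgr_lt _ cn _ zr.
  by apply: filterS => y /ltW yr; apply: zmax; exact/mem_set.
have := Lu Uz; have : 0 < e * elliptic_barrier A nu p (a z) (b z) z by exact: mulr_gt0.
lra.
Qed.

(** Row vectors carry the sup norm, whereas the touching sphere is Euclidean; this bound and the
    next one translate between the two. *)
Let sup_norm_le_dot (x : 'rV[R]_k) : `|x| ^+ 2 <= dot x x.
Proof.
have [->|x0] := eqVneq x 0; first by rewrite normr0 expr0n dotvv_ge0.
have [[i j] /= E] : exists ij, `|x| = `|x ij.1 ij.2| 
  by apply: mx_norm_neq0; apply: contra_neq x0 => /mx_norm_eq0.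
rewrite E (ord1 i) real_normK ?num_real// dotE (bigD1 j)//= -expr2 lerDl.
by apply: sumr_ge0 => l _; rewrite -expr2 sqr_ge0.
Qed.

Let dot_le_sup_norm (x : 'rV[R]_k) : dot x x <= k%:R * `|x| ^+ 2.
Proof.
rewrite dotE mulr_natl -[X in _ *+ X]card_ord -sumr_const; apply: ler_sum => i _.
rewrite -expr2 -[leLHS]real_normK ?num_real// lerXn2r// ?nnegrE//.
rewrite [leRHS]/Num.norm /= mx_normrE.
exact: (le_bigmax _ (fun ij => `|x ij.1 ij.2|) (0, i)).
Qed.

(** A non-maximal [q] close to [x0] would have a Euclidean-nearest maximum point [p], and the ball
    about [q] through [p] would touch the maximum set from outside, against [no_touching]. *)
Lemma strong_maximum_principle x0 : U x0 -> u x0 = M ->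
  \forall x \near x0, u x = M.
Proof.
move=> Ux0 ux0.
have [r r0 rU] : exists2 r : R, 0 < r & forall x, `|x - x0| <= r -> U x.
  have /nbhs_ballP[e /= e0 eU] := open_nbhs_nbhs (conj oU Ux0).
  exists (e / 2); first by rewrite divr_gt0.
  move=> x xp; apply: eU; rewrite mx_norm_ball /ball_ /= distrC (le_lt_trans xp)//.
  by rewrite ltr_pdivrMr// ltr_pMr// ltr1n.
(* Comparing norms costs a factor sqrt k, bounded by k + 1, in the distance from [q] to [p], and the
   triangle inequality adds 1. With [q] within r / (k + 2) of [x0], the point [p] is interior to the
   ball of radius r, so its minimality holds in a full neighbourhood. *)
pose c : R := k.+2%:R; have c0 : 0 < c by rewrite ltr0n.
apply/nbhs_ballP; exists (r / c) => /=; first by rewrite divr_gt0.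
move=> q; rewrite mx_norm_ball /ball_ /= distrC => qx0.
apply/eqP/contraT => uq.
have qr : `|q - x0| * c < r by rewrite -ltr_pdivlMr.
have {uq} uq : u q < M.
  rewrite lt_neqAle uq uM//; apply: rU; apply: ltW; apply: le_lt_trans qr.
  by rewrite ler_peMr// ler1n.
pose K := [set x : 'rV[R]_k | `|x - x0| <= r] `&` [set x | u x = M].
have cB := @compact_closed_ball_rV x0 r.
have clB : closed [set x : 'rV[R]_k | `|x - x0| <= r].
  by apply: compact_closed => //; exact: norm_hausdorff.
have clK : closed K.
  (* Continuity of [u] is available only on [U], so a limit point is first placed in the closed
     ball, which lies in [U]. *)
  move=> x clx; have Bx : `|x - x0| <= r.
    by apply: clB => V /clx [y [[By _] Vy]]; exists y.
  split=> //=; apply/eqP/contraT => uxM.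
  have {}uxM : u x < M by rewrite lt_neqAle uxM uM//; exact: rU.
  have /clx [y [[_ /= uyM]]] : nbhs x [set y | u y < M].
    exact: (cvgr_lt _ (cu (rU x Bx)) _ uxM).
  by rewrite /= uyM ltxx.
have cK : compact K by apply: subclosed_compact clK cB _ => x [].
have Kx0 : K x0 by split => //=; rewrite subrr normr0 ltW.
have cd (x : 'rV[R]_k) : {for x, continuous (fun y : 'rV[R]_k => dot (y - q) (y - q))}.
  exact: (cvg_dot (@cvg_center q x) (@cvg_center q x)).
have [p /set_mem Kp pmin] : exists2 p : 'rV[R]_k, p \in K &
    forall x, x \in K -> dot (p - q) (p - q) <= dot (x - q) (x - q).
  apply: (@EVT_min_rV _ _ (fun x => dot (x - q) (x - q))) => //; first by exists x0.
  by apply: continuous_in_subspaceT => x _; exact: cd.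
have pq : `|p - q| <= k.+1%:R * `|x0 - q|.
  rewrite -(@ler_pXn2r _ 2)// ?nnegrE ?mulr_ge0//.
  apply: le_trans (sup_norm_le_dot _) _.
  apply: le_trans (pmin x0 (mem_set Kx0)) _.
  apply: le_trans (dot_le_sup_norm _) _.
  rewrite exprMn ler_wpM2r ?sqr_ge0// -natrX ler_nat.
  by rewrite expnS expn1 mulnS (leq_trans (leqnSn k))// leq_addr.
have px0 : `|p - x0| < r.
  apply: le_lt_trans qr; have -> : p - x0 = (p - q) + (q - x0) by rewrite subrKA.
  apply: le_trans (ler_normD _ _) _; rewrite (distrC q) /c -natr1 mulrDr mulr1.
  by move: pq; lra.
suff : False by [].
(* With this normal the touching ball is centred at p - (p - q) = q. *)
apply: (@no_touching (p - q) p (rU _ Kp.1) Kp.2).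
  by apply: contraTneq uq => /subr0_eq <-; rewrite Kp.2 ltxx.
have n1 : nbhs p (fun x => `|x - x0| < r).
  exact: (cvgr_lt _ (@cvg_dist_center x0 p) _ px0).
apply: (@filterS _ (nbhs p) _ _ _ _ n1) => x /ltW xr xq.
rewrite lt_neqAle uM ?andbT; last exact: rU.
apply/eqP => uxM; have := pmin x (mem_set (conj xr uxM : K x)).
rewrite leNgt => /negP; apply.
move: xq; rewrite -[x - q](subrKA p); move: (x - p) (p - q) => v w.
by rewrite !(dotDl, dotDr) (dotC w v); lra.
Qed.

End strong_maximum_principle.

(** * Limits of geometric quantities *)

Section geometric_limits.
Context {R : realType} {k n : nat}.
Variables (G : 'rV[R]_n -> 'M[R]_n) (phi : 'rV[R]_k -> 'rV[R]_n).
Context {F : set_system 'rV[R]_k} {FF : Filter F}.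
Variable x : 'rV[R]_k.
Hypothesis cphi : forall i, pderiv i phi @ F --> pderiv i phi x.
Hypothesis cphi2 : forall i j, pderiv i (pderiv j phi) @ F --> pderiv i (pderiv j phi) x.
Hypothesis cJ : (fun y => 'J phi y) @ F --> 'J phi x.
Hypothesis cG : G \o phi @ F --> G (phi x).
Hypothesis cdG : forall b, pderiv b G \o phi @ F --> pderiv b G (phi x).
Hypothesis uG : G (phi x) \in unitmx.
Hypothesis uh : first_form G phi x \in unitmx.

Lemma cvg_first_form : (fun y => first_form G phi y) @ F --> first_form G phi x.
Proof. exact: (cvg_mulmx (cvg_mulmx cJ cG) (cvg_trmx cJ)). Qed.

Lemma cvg_invmx_first_form :
  (fun y => invmx (first_form G phi y)) @ F --> invmx (first_form G phi x).
Proof. exact: (cvg_invmx uh cvg_first_form). Qed.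

Lemma cvg_christoffel a b c :
  (fun y => christoffel G (phi y) a b c) @ F --> christoffel G (phi x) a b c.
Proof.
have cD d e f : (fun y => pderiv d G (phi y) e f) @ F --> pderiv d G (phi x) e f.
  by have := @cvg_entry R _ F n n (pderiv d G \o phi) (pderiv d G (phi x)) e f (@cdG d).
have cI : (fun y => invmx (G (phi y))) @ F --> invmx (G (phi x)).
  exact: (cvg_invmx uG cG).
apply: cvgM; first exact: cvg_cst.
apply: cvg_sumr => e _; apply: cvgM.
  by have := @cvg_entry R _ F n n _ _ a e cI.
by apply: cvgB; first apply: cvgD.
Qed.

Lemma cvg_cov_deriv i j :
  (fun y => cov_deriv G phi y i j) @ F --> cov_deriv G phi x i j.
Proof.
apply: cvgD => //; apply: cvg_mx => r a; rewrite mxE; under eq_fun do rewrite mxE.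
apply: cvg_sumr => b _; apply: cvg_sumr => c _.
apply: cvgM; last by have := @cvg_entry R _ F 1 n (pderiv j phi) _ 0 c (@cphi j).
apply: cvgM; first exact: cvg_christoffel.
by have := @cvg_entry R _ F 1 n (pderiv i phi) _ 0 b (@cphi i).
Qed.

End geometric_limits.

Section first_form_facts.
Context {R : realType} {k n : nat}.
Variables (G : 'rV[R]_n -> 'M[R]_n) (phi : 'rV[R]_k -> 'rV[R]_n) (x : 'rV[R]_k).
Hypothesis symG : (G (phi x))^T = G (phi x).
Hypothesis posG : forall v, v != 0 -> 0 < qform (G (phi x)) v.
Hypothesis freeJ : row_free ('J phi x).

Lemma first_form_sym : (first_form G phi x)^T = first_form G phi x.
Proof. by rewrite /first_form !trmx_mul trmxK symG mulmxA. Qed.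

Lemma first_form_gt0 (v : 'rV[R]_k) : v != 0 ->
  0 < (v *m first_form G phi x *m v^T) 0 0.
Proof.
move=> v0; have -> : v *m first_form G phi x *m v^T =
    (v *m 'J phi x) *m G (phi x) *m (v *m 'J phi x)^T.
  by rewrite trmx_mul !mulmxA.
apply: posG; apply: contra_neq v0 => vJ.
by apply: (row_free_inj freeJ); rewrite vJ mul0mx.
Qed.

End first_form_facts.

Section smooth_calculus.
Context {R : realType}.

Lemma smooth_on_sub (V W : normedModType R) (U U' : set V) (f : V -> W) :
  U' `<=` U -> smooth_on U f -> smooth_on U' f.
Proof. by move=> U'U sf s x /U'U; exact: sf. Qed.

Lemma derive_comp_linear (V W X : normedModType R) (L : {linear V -> W})
    (f : W -> X) (v x : V) : 'D_v (f \o L) x = 'D_(L v) f (L x).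
Proof.
rewrite /derive; apply: (congr1 (fun h : R -> X => lim (h @ 0^'))).
by apply/funext => h /=; rewrite linearP.
Qed.

Lemma derive_linear_comp (V W X : normedModType R) (L : {linear W -> X})
    (f : V -> W) (v x : V) : continuous L -> differentiable f x ->
  'D_v (L \o f) x = L ('D_v f x).
Proof.
move=> cL df; have dL : differentiable L (f x) by exact: linear_differentiable.
rewrite !deriveE//; last exact: differentiable_comp.
by rewrite (diff_comp df dL) /= (diff_lin _ cL).
Qed.

Lemma cvg_jacobian k n (U : set 'rV[R]_k) (f : 'rV[R]_k -> 'rV[R]_n) (x : 'rV[R]_k) :
  open U -> U x -> smooth_on U f ->
  (fun y => 'J f y) @ x --> 'J f x.
Proof.
move=> oU Ux sf; apply: (@cvg_mx _ (nbhs x) (nbhs_filter x)) => i j.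
have JE y : U y -> 'J f y i j = pderiv i f y 0 j.
  by move=> Uy; rewrite -jacobianE ?mxE//; exact: (sf [::]).
have h : (fun y => pderiv i f y 0 j) @ x --> 'J f x i j.
  rewrite (JE x Ux); have := differentiable_continuous (sf [:: delta_mx 0 i] x Ux).
  exact: cvg_entry.
apply: cvg_trans h; apply: near_eq_cvg.
by apply: (@filterS _ (nbhs x) _ _ _ _ (open_nbhs_nbhs (conj oU Ux))) => y /JE.
Qed.

Lemma cvg_smooth_comp k n (W : normedModType R) (U : set 'rV[R]_k) (V : set 'rV[R]_n)
    (f : 'rV[R]_k -> 'rV[R]_n) (h : 'rV[R]_n -> W) (x : 'rV[R]_k) :
  U x -> V (f x) -> smooth_on U f -> (forall y, V y -> differentiable h y) ->
  h \o f @ x --> h (f x).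
Proof.
move=> Ux Vx sf dh; apply: continuous_comp.
  exact: differentiable_continuous (sf [::] x Ux).
exact/differentiable_continuous/dh.
Qed.

End smooth_calculus.

(** * The metric beta dt^2 + g_t in a chart *)

Section chart_split.
Context {R : realType} {m : nat}.

(** Packaged as a linear map, as are the two block embeddings below: the metric becomes a sum of
    smooth maps composed with linear ones on both sides, and no product rule is needed. *)
Definition chart_split (y : 'rV[R]_(1 + m)) : R * 'rV[R]_m :=
  (lsubmx y 0 0, rsubmx y).

Fact chart_split_is_linear : linear chart_split.
Proof.
by move=> c y z; apply: injective_projections => /=; rewrite ?linearP // !mxE.
Qed.
HB.instance Definition _ :=
  GRing.isLinear.Build R _ _ _ chart_split chart_split_is_linear.

Lemma chart_split_continuous : continuous chart_split.
Proof.
move=> y; have c1 : {for y, continuous (fun z : 'rV[R]_(1 + m) => lsubmx z 0 0)}.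
  apply: (continuous_comp (g := fun B : 'M[R]_(1, 1) => B 0 0)).
    exact: continuous_lsubmx.
  exact: coord_continuous.
exact: (cvg_pair c1 (@continuous_rsubmx _ _ _ _ y)).
Qed.

Definition time_block (c : R) : 'M[R]_(1 + m) := block_mx c%:M 0 0 0.

Fact time_block_is_linear : linear time_block.
Proof.
move=> c s t; rewrite /time_block scale_block_mx add_block_mx !scaler0 !addr0.
by rewrite scale_scalar_mx -raddfD.
Qed.

HB.instance Definition _ :=
  GRing.isLinear.Build R _ _ _ time_block time_block_is_linear.

Lemma time_block_continuous : continuous time_block.
Proof.
move=> c; have E : time_block = (fun t => t *: time_block 1).
  by apply/funext => t; rewrite -linearZ /= [_ *: _]mulr1.
by rewrite E; exact: scalel_continuous.
Qed.

Definition space_block (B : 'M[R]_m) : 'M[R]_(1 + m) := block_mx 0 0 0 B.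

Fact space_block_is_linear : linear space_block.
Proof.
by move=> c B C; rewrite /space_block scale_block_mx add_block_mx !scaler0 !addr0.
Qed.
HB.instance Definition _ :=
  GRing.isLinear.Build R _ _ _ space_block space_block_is_linear.

Lemma space_block_continuous : continuous space_block.
Proof.
move=> B; pose P : 'M[R]_(m, 1 + m) := row_mx 0 1%:M.
have E : space_block = (fun C => P^T *m C *m P).
  apply/funext => C; rewrite /P tr_row_mx trmx0 trmx1 mul_col_mx mul0mx mul1mx.
  by rewrite mul_col_row !mul0mx mulmx0 mulmx1.
have cid : (fun C : 'M[R]_m => C) @ B --> B by [].
have cP : (fun _ : 'M[R]_m => P) @ B --> P by exact: (@cvg_cst _ P _ (nbhs B) _).
have cPT : (fun _ : 'M[R]_m => P^T) @ B --> P^T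
  by exact: (@cvg_cst _ P^T _ (nbhs B) _).
by rewrite E; exact: (cvg_mulmx (cvg_mulmx cPT cid) cP).
Qed.

End chart_split.

Section warped_metric.
Context {R : realType} {m : nat}.
Variables (I : set R) (D : set 'rV[R]_m).
Variables (beta : R -> R) (gam : R -> 'rV[R]_m -> 'M[R]_m).
Hypotheses (oI : open I) (oD : open D).
Hypothesis beta_smooth : smooth_on I beta.
Hypothesis gam_smooth : smooth_on (I `*` D) (fun z => gam z.1 z.2).

Definition warped (y : 'rV[R]_(1 + m)) : 'M[R]_(1 + m) :=
  block_mx (beta (lsubmx y 0 0))%:M 0 0 (gam (lsubmx y 0 0) (rsubmx y)).

Definition warped_dom : set 'rV[R]_(1 + m) := chart_split @^-1` (I `*` D).

Lemma open_warped_dom : open warped_dom.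
Proof.
apply: open_comp; first by move=> y _; exact: chart_split_continuous.
rewrite openE => -[t w] [/= It Dw]; exists (I, D) => //=.
by split; exact: open_nbhs_nbhs.
Qed.

Let beta_split_smooth : smooth_on (I `*` D) (beta \o fst).
Proof.
apply: (@smooth_on_sub _ _ _ ((fst : R * 'rV[R]_m -> R) @^-1` I)); first by move=> ? [].
by apply: smooth_on_comp_linear => // z; exact: cvg_fst.
Qed.

Let warpedE : warped = (time_block \o (beta \o fst \o chart_split)) \+
  (space_block \o ((fun z => gam z.1 z.2) \o chart_split)).
Proof.
by apply/funext => y; rewrite /= /time_block /space_block add_block_mx !addr0 add0r.
Qed.

Lemma warped_smooth : smooth_on warped_dom warped.
Proof.
have oW := open_warped_dom.
rewrite warpedE; apply: smooth_onD => //.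
  apply: smooth_on_linear_comp => //; first exact: time_block_continuous.
  by apply: smooth_on_comp_linear => //; exact: chart_split_continuous.
apply: smooth_on_linear_comp => //; first exact: space_block_continuous.
by apply: smooth_on_comp_linear => //; exact: chart_split_continuous.
Qed.

Let derive_warped v y : warped_dom y -> 'D_v warped y =
  time_block ('D_(lsubmx v 0 0) beta (lsubmx y 0 0)) +
  space_block ('D_(chart_split v) (fun z => gam z.1 z.2) (chart_split y)).
Proof.
move=> [Iy Dy].
have d1 : differentiable (beta \o fst \o chart_split) y.
  apply: differentiable_comp; last by apply: (beta_split_smooth [::]); split.
  by apply: linear_differentiable; exact: chart_split_continuous.
have d2 : differentiable ((fun z => gam z.1 z.2) \o chart_split) y.
  apply: differentiable_comp; last by apply: (gam_smooth [::]); split.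
  by apply: linear_differentiable; exact: chart_split_continuous.
have e1 := derive_linear_comp v (@time_block_continuous R m) d1.
have e2 := derive_linear_comp v space_block_continuous d2.
rewrite warpedE deriveD; first last.
- apply: diff_derivable; apply: differentiable_comp => //.
  by apply: linear_differentiable; exact: space_block_continuous.
- apply: diff_derivable; apply: differentiable_comp => //.
  by apply: linear_differentiable; exact: time_block_continuous.
apply: (congr2 +%R).
  apply: (etrans e1); apply: (congr1 time_block).
  apply: (etrans (derive_comp_linear (@chart_split R m) (beta \o fst) v y)).
  exact: (derive_comp_linear (fst : R * 'rV[R]_m -> R) beta (chart_split v) (chart_split y)).
apply: (etrans e2); apply: (congr1 space_block).
exact: (derive_comp_linear (@chart_split R m) (fun z => gam z.1 z.2) v y).
Qed.

Lemma pderiv_time_warped y : warped_dom y ->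
  pderiv (lshift m 0) warped y =
  block_mx (derive1 beta (lsubmx y 0 0))%:M 0 0
    (derive1 (fun s => gam s (rsubmx y)) (lsubmx y 0 0)).
Proof.
move=> Dy; rewrite /pderiv derive_warped//.
have -> : chart_split (delta_mx 0 (lshift m 0) : 'rV[R]_(1 + m)) = (1, 0).
  rewrite /chart_split; apply: (congr2 pair); first by rewrite !mxE !eqxx.
  by apply/rowP => i; rewrite !mxE eq_rlshift andbF.
have -> : lsubmx (delta_mx 0 (lshift m 0) : 'rV[R]_(1 + m)) 0 0 = 1.
  by rewrite !mxE !eqxx.
rewrite -derive1E /time_block /space_block add_block_mx !addr0 add0r.
congr block_mx; rewrite derive1E /derive.
(* The derivative along (1, 0) and the derivative in t at a fixed point of [F] are limits of the
   same difference quotient. *)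
apply: (congr1 (fun h : R -> 'M[R]_m => lim (h @ 0^'))).
by apply/funext => h /=; rewrite scaler0 add0r.
Qed.

Lemma pderiv_space_warped y i : warped_dom y ->
  pderiv (rshift 1 i) warped y =
  space_block (pderiv i (gam (lsubmx y 0 0)) (rsubmx y)).
Proof.
move=> Dy; rewrite /pderiv derive_warped//.
have -> : chart_split (delta_mx 0 (rshift 1 i) : 'rV[R]_(1 + m)) = (0, delta_mx 0 i).
  rewrite /chart_split; apply: (congr2 pair); first by rewrite !mxE eq_lrshift andbF.
  by apply/rowP => j; rewrite !mxE eq_rshift.
have -> : lsubmx (delta_mx 0 (rshift 1 i) : 'rV[R]_(1 + m)) 0 0 = 0.
  by rewrite !mxE eq_lrshift andbF.
rewrite derive0 linear0 add0r; congr space_block; rewrite /derive.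
apply: (congr1 (fun h : R -> 'M[R]_m => lim (h @ 0^'))).
by apply/funext => h /=; rewrite scaler0 add0r.
Qed.

End warped_metric.

(** * Christoffel symbols of a block-diagonal metric *)

Section warped_christoffel.
Context {R : realType} {m : nat}.
Variables (W : 'rV[R]_(1 + m) -> 'M[R]_(1 + m)) (y : 'rV[R]_(1 + m)).
Variables (beta dbeta : R) (igam dgam : 'M[R]_m) (pgam : 'I_m -> 'M[R]_m).
Hypothesis invW : invmx (W y) = block_mx beta^-1%:M 0 0 igam.
Hypothesis dtW : pderiv (lshift m 0) W y = block_mx dbeta%:M 0 0 dgam.
Hypothesis dxW : forall i, pderiv (rshift 1 i) W y = block_mx 0 0 0 (pgam i).

Lemma christoffel_time b c : christoffel W y (lshift m 0) b c =
  2^-1 * (beta^-1 * (pderiv b W y (lshift m 0) c + pderiv c W y (lshift m 0) b -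
                     pderiv (lshift m 0) W y b c)).
Proof.
rewrite /christoffel invW big_split_ord /= big_ord1 [X in _ + X]big1 ?addr0.
  by rewrite block_mxEul mxE eqxx.
by move=> e _; rewrite block_mxEur mxE mul0r.
Qed.

Lemma christoffel_space a b c :
  christoffel W y (rshift 1 a) (rshift 1 b) (rshift 1 c) =
  2^-1 * \sum_e igam a e * (pgam b e c + pgam c e b - pgam e b c).
Proof.
rewrite /christoffel invW big_split_ord /= big_ord1.
rewrite block_mxEdl mxE mul0r add0r; congr (_ * _); apply: eq_bigr => e _.
by rewrite !dxW !block_mxEdr.
Qed.

(** The mixed symbols Gamma^t_{ti} vanish since beta depends on t alone; Gamma^t_{tt} is beta' / (2
    beta), and the spatial Gamma^t_{ij} are the entries of - d_t g / (2 beta). *)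
Lemma sum_christoffel_time (X Y : 'rV[R]_(1 + m)) :
  \sum_b \sum_c christoffel W y (lshift m 0) b c * X 0 b * Y 0 c =
  (2 * beta)^-1 * (dbeta * X 0 (lshift m 0) * Y 0 (lshift m 0) -
                   (rsubmx X *m dgam *m (rsubmx Y)^T) 0 0).
Proof.
have C00 : christoffel W y (lshift m 0) (lshift m 0) (lshift m 0) =
    (2 * beta)^-1 * dbeta.
  by rewrite christoffel_time dtW block_mxEul mxE eqxx addrK mulrA -invfM.
have C0r c : christoffel W y (lshift m 0) (lshift m 0) (rshift 1 c) = 0.
  by rewrite christoffel_time dtW dxW block_mxEur block_mxEul !mxE !addr0 subr0 !mulr0.
have Cr0 b : christoffel W y (lshift m 0) (rshift 1 b) (lshift m 0) = 0.
  by rewrite christoffel_time dtW dxW block_mxEur block_mxEul block_mxEdl !mxE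
    !addr0 subr0 !mulr0.
have Crr b c : christoffel W y (lshift m 0) (rshift 1 b) (rshift 1 c) =
    - ((2 * beta)^-1 * dgam b c).
  rewrite christoffel_time dtW !dxW !block_mxEur block_mxEdr !mxE !add0r.
  by rewrite !mulrN mulrA -invfM.
rewrite big_split_ord /= big_ord1 big_split_ord /= big_ord1 C00.
rewrite [X in _ + X + _]big1 ?addr0; last by move=> c _; rewrite C0r !mul0r.
rewrite mulrBr !mulrA; congr (_ + _).
transitivity (\sum_b \sum_c
    - ((2 * beta)^-1 * (X 0 (rshift 1 b) * dgam b c * Y 0 (rshift 1 c)))).
  apply: eq_bigr => b _; rewrite big_split_ord /= big_ord1 Cr0 !mul0r add0r.
  by apply: eq_bigr => c _; rewrite Crr; ring.
rewrite exchange_big /= mxE mulr_sumr -sumrN; apply: eq_bigr => c _.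
rewrite sumrN -mulr_sumr; congr (- (_ * _)); rewrite mxE mulr_suml.
by apply: eq_bigr => b _; rewrite !mxE.
Qed.

End warped_christoffel.

(** * The time component of the mean curvature *)

Section matrix_entries.
Context {R : comNzRingType}.

Lemma rsubmx_row k n1 n2 (M : 'M[R]_(k, n1 + n2)) i :
  rsubmx (row i M) = row i (rsubmx M).
Proof. by apply/rowP => a; rewrite !mxE. Qed.

Lemma gram_entry k n (P : 'M[R]_(k, n)) (D : 'M[R]_n) i j :
  (P *m D *m P^T) i j = (row i P *m D *m (row j P)^T) 0 0.
Proof.
rewrite -row_mul tr_row [RHS]mxE [LHS]mxE.
by apply: eq_bigr => l _; rewrite !mxE.
Qed.

Lemma quadratic_entry k n (A : 'M[R]_k) (J : 'M[R]_(k, n)) a :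
  ((col a J)^T *m A *m J) 0 a = \sum_i \sum_j A i j * (J i a * J j a).
Proof.
rewrite mxE exchange_big /=; apply: eq_bigr => j _; rewrite mxE mulr_suml.
by apply: eq_bigr => i _; rewrite !mxE mulrA [A i j * _]mulrC.
Qed.

End matrix_entries.

Section time_component.
Context {R : realType} {k m : nat}.
Variables (W : 'rV[R]_(1 + m) -> 'M[R]_(1 + m)) (phi : 'rV[R]_k -> 'rV[R]_(1 + m)).

(** Coefficients, in the frame of the d_l phi, of the tangential projection of the covariant
    derivative. *)
Definition tangent_coef (x : 'rV[R]_k) (i j : 'I_k) : 'rV[R]_k :=
  cov_deriv W phi x i j *m W (phi x) *m ('J phi x)^T *m invmx (first_form W phi x).

(* c stands for beta' / (2 beta). *)
Definition time_drift (c : R) (x : 'rV[R]_k) : 'rV[R]_k :=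
  let h' := invmx (first_form W phi x) in
  c *: ((col (lshift m 0) ('J phi x))^T *m h') -
  \sum_i \sum_j h' i j *: tangent_coef x i j.

Variable x : 'rV[R]_k.
Variables (beta dbeta : R) (igam dgam : 'M[R]_m) (pgam : 'I_m -> 'M[R]_m).
Hypothesis rowJ : forall i, row i ('J phi x) = pderiv i phi x.
Hypothesis invW : invmx (W (phi x)) = block_mx beta^-1%:M 0 0 igam.
Hypothesis dtW : pderiv (lshift m 0) W (phi x) = block_mx dbeta%:M 0 0 dgam.
Hypothesis dxW : forall i, pderiv (rshift 1 i) W (phi x) = block_mx 0 0 0 (pgam i).

Local Notation h' := (invmx (first_form W phi x)).
Local Notation J := ('J phi x).

Let JE i a : J i a = pderiv i phi x 0 a.
Proof. by rewrite -rowJ [RHS]mxE. Qed.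

Let B := rsubmx J *m dgam *m (rsubmx J)^T.

Let BE i j : B i j = (rsubmx (pderiv i phi x) *m dgam *m (rsubmx (pderiv j phi x))^T) 0 0.
Proof.
by rewrite -!rowJ !rsubmx_row -gram_entry.
Qed.

(** Every term with a factor from the t-column of [J], which is d tau, is collected as a product of
    [time_drift] with that column: the projection is [tangent_coef *m J], and c h^ij d_i tau d_j tau
    is the pairing of c h^-1 d tau with d tau. *)
Lemma mean_curvature_time : mean_curvature W phi x 0 (lshift m 0) =
  frob h' (\matrix_(i, j) pderiv i (pderiv j phi) x 0 (lshift m 0)) +
  (time_drift ((2 * beta)^-1 * dbeta) x *m J) 0 (lshift m 0) -
  (2 * beta)^-1 * frob h' B.
Proof.
have -> : time_drift ((2 * beta)^-1 * dbeta) x *m J =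
    ((2 * beta)^-1 * dbeta) *: ((col (lshift m 0) J)^T *m h' *m J) -
    \sum_i \sum_j h' i j *: (tangent_coef x i j *m J).
  rewrite mulmxBl -scalemxAl; congr (_ - _).
  rewrite mulmx_suml; apply: eq_bigr => i _; rewrite mulmx_suml.
  by apply: eq_bigr => j _; rewrite -scalemxAl.
have quadE : ((col (lshift m 0) J)^T *m h' *m J) 0 (lshift m 0) =
    \sum_i \sum_j h' i j * (J i (lshift m 0) * J j (lshift m 0)).
  exact: quadratic_entry.
have secondE i j : second_form W phi x i j 0 (lshift m 0) =
    pderiv i (pderiv j phi) x 0 (lshift m 0) +
    (2 * beta)^-1 * (dbeta * (J i (lshift m 0) * J j (lshift m 0)) - B i j) -
    (tangent_coef x i j *m J) 0 (lshift m 0).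
  rewrite [LHS]mxE; congr (_ + _); last by rewrite [LHS]mxE.
  rewrite [LHS]mxE; congr (_ + _); rewrite [LHS]mxE.
  by rewrite (sum_christoffel_time invW dtW dxW) BE !JE !mulrA.
rewrite [X in _ + X - _]mxE [X in _ + (X + _) - _]mxE quadE.
rewrite [X in _ + (_ + X) - _]mxE /mean_curvature !summxE /frob !mulr_sumr.
rewrite -!sumrB -big_split -sumrB /=; apply: eq_bigr => i _.
rewrite !summxE !mulr_sumr -!sumrB -big_split -sumrB /=; apply: eq_bigr => j _.
rewrite [LHS]mxE secondE [X in _ = _ * X + _ - _]mxE [X in _ = _ + (_ - X) - _]mxE.
by ring.
Qed.

Lemma time_component_minimal (Q : 'M[R]_k) : mean_curvature W phi x = 0 ->
  h' = Q^T *m Q ->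
  frob h' (\matrix_(i, j) pderiv i (pderiv j phi) x 0 (lshift m 0)) +
  \sum_l time_drift ((2 * beta)^-1 * dbeta) x 0 l * pderiv l phi x 0 (lshift m 0) =
  (2 * beta)^-1 * \sum_l qform dgam (row l Q *m rsubmx J).
Proof.
move=> H0 hQ; have := mean_curvature_time; rewrite H0 mxE.
move/esym/eqP; rewrite subr_eq0 => /eqP; rewrite mxE.
under [X in _ + X]eq_bigr do rewrite JE.
move=> ->; congr (_ * _); rewrite hQ frob_gram; apply: eq_bigr => l _.
by rewrite /qform /B trmx_mul !mulmxA.
Qed.

End time_component.

Section drift_limit.
Context {R : realType} {k m : nat}.
Variables (W : 'rV[R]_(1 + m) -> 'M[R]_(1 + m)) (phi : 'rV[R]_k -> 'rV[R]_(1 + m)).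
Context {F : set_system 'rV[R]_k} {FF : Filter F}.
Variables (x : 'rV[R]_k) (c : 'rV[R]_k -> R).
Hypothesis cc : c @ F --> c x.
Hypothesis cJ : (fun y => 'J phi y) @ F --> 'J phi x.
Hypothesis cW : W \o phi @ F --> W (phi x).
Hypothesis ccov : forall i j,
  (fun y => cov_deriv W phi y i j) @ F --> cov_deriv W phi x i j.
Hypothesis ch' :
  (fun y => invmx (first_form W phi y)) @ F --> invmx (first_form W phi x).

Lemma cvg_time_drift : (fun y => time_drift W phi (c y) y) @ F -->
  time_drift W phi (c x) x.
Proof.
pose e := delta_mx (lshift m 0) 0 : 'cV[R]_(1 + m).
have ce : (fun _ : 'rV[R]_k => e) @ F --> e by exact: (@cvg_cst _ e _ F FF).
have cJe : (fun y => 'J phi y *m e) @ F --> 'J phi x *m e by exact: (cvg_mulmx cJ ce).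
have cJet : (fun y => ('J phi y *m e)^T) @ F --> ('J phi x *m e)^T by exact: (cvg_trmx cJe).
have E (y : 'rV[R]_k) : (col (lshift m 0) ('J phi y))^T = ('J phi y *m e)^T.
  by rewrite colE.
have EF := funext E.
have ccol : (fun y => (col (lshift m 0) ('J phi y))^T) @ F -->
    (col (lshift m 0) ('J phi x))^T.
  by rewrite EF (E x).
have ct i j : (fun y => tangent_coef W phi y i j) @ F --> tangent_coef W phi x i j.
  have h1 : (fun y => cov_deriv W phi y i j *m W (phi y)) @ F -->
      cov_deriv W phi x i j *m W (phi x) by exact: (cvg_mulmx (@ccov i j) cW).
  have h2 : (fun y => cov_deriv W phi y i j *m W (phi y) *m ('J phi y)^T) @ F -->
      cov_deriv W phi x i j *m W (phi x) *m ('J phi x)^T.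
    exact: (cvg_mulmx h1 (cvg_trmx cJ)).
  exact: (cvg_mulmx h2 ch').
have ch'ij i j : (fun y => invmx (first_form W phi y) i j) @ F -->
    invmx (first_form W phi x) i j by exact: cvg_entry ch'.
apply: cvgB; first exact: (cvgZ cc (cvg_mulmx ccol ch')).
by apply: cvg_sumr => i _; apply: cvg_sumr => j _; exact: (cvgZ (ch'ij i j) (ct i j)).
Qed.

End drift_limit.

Section warped_spd.
Context {R : realType} {m : nat}.

Lemma qform_block (b : R) (D : 'M[R]_m) (v : 'rV[R]_(1 + m)) :
  qform (block_mx b%:M 0 0 D) v = b * v 0 (lshift m 0) ^+ 2 + qform D (rsubmx v).
Proof.
rewrite /qform -{1 2}(hsubmxK v) mul_row_block !mulmx0 addr0 add0r.
rewrite tr_row_mx mul_row_col mxE; congr (_ + _).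
by rewrite mul_mx_scalar -scalemxAl mxE mxE big_ord1 !mxE expr2.
Qed.

Lemma qform_block_gt0 (b : R) (D : 'M[R]_m) (v : 'rV[R]_(1 + m)) : 0 < b ->
  (forall w, w != 0 -> 0 < qform D w) -> v != 0 -> 0 < qform (block_mx b%:M 0 0 D) v.
Proof.
move=> b0 D0 v0; rewrite qform_block; have [r0|r0] := eqVneq (rsubmx v) 0.
  rewrite r0 /qform mul0mx mul0mx mxE addr0 mulr_gt0// exprn_even_gt0//=.
  apply: contra_neq v0 => l0; rewrite -[v]hsubmxK r0 -row_mx0; congr row_mx.
  by apply/rowP => i; rewrite ord1 !mxE.
by rewrite ltr_wpDl ?D0// mulr_ge0 ?sqr_ge0// ltW.
Qed.

End warped_spd.

Lemma open_coord_image (R : realType) k (S : manifold R k) (a : chart S) (A : set S) :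
  open A -> A `<=` dom a -> open (coord a @` A).
Proof.
move=> oA Aa; rewrite openE => _ [p Ap <-].
have cp : nbhs (coord a p) (coord a @` dom a).
  by apply: open_nbhs_nbhs; split; [exact: image_open|exists p => //; exact: Aa].
have Ap' : nbhs (param a (coord a p)) A.
  by rewrite coordK; [exact: open_nbhs_nbhs|exact: Aa].
have := param_continuous_at (Aa _ Ap) Ap'; apply: filterS2 cp => _ [q aq <-] /=.
by rewrite coordK// => Aq; exists q.
Qed.

(** * Slices *)

Section slice.
Context {R : realType} {k m : nat}.
Variables (W : 'rV[R]_(1 + m) -> 'M[R]_(1 + m)) (phi : 'rV[R]_k -> 'rV[R]_(1 + m)).
Variables (G : 'rV[R]_m -> 'M[R]_m) (psi : 'rV[R]_k -> 'rV[R]_m).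
Variables (x : 'rV[R]_k) (beta : R).
Hypothesis WE : W (phi x) = block_mx beta%:M 0 0 (G (psi x)).
Hypothesis uW : W (phi x) \in unitmx.
Hypothesis dxW : forall i,
  pderiv (rshift 1 i) W (phi x) = block_mx 0 0 0 (pderiv i G (psi x)).
Hypothesis dphi : forall i, pderiv i phi x = row_mx 0 (pderiv i psi x).
Hypothesis ddphi : forall i j,
  rsubmx (pderiv i (pderiv j phi) x) = pderiv i (pderiv j psi) x.
Hypothesis JE : 'J phi x = row_mx 0 ('J psi x).

Let invW : invmx (W (phi x)) = block_mx beta^-1%:M 0 0 (invmx (G (psi x))).
Proof. by move: uW; rewrite WE => /invmx_block_diag ->; rewrite invmx_scalar. Qed.

Let rsubmx_mul_metric (w : 'rV[R]_(1 + m)) :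
  w *m W (phi x) *m ('J phi x)^T = rsubmx w *m G (psi x) *m ('J psi x)^T.
Proof.
rewrite WE JE -{1}(hsubmxK w) mul_row_block !mulmx0 addr0 add0r.
by rewrite tr_row_mx mul_row_col trmx0 mulmx0 add0r.
Qed.

Let first_formE : first_form W phi x = first_form G psi x.
Proof.
apply/row_matrixP => i; rewrite /first_form -!mulmxA !row_mul !mulmxA rsubmx_mul_metric.
by rewrite JE row_row_mx row_mxKr.
Qed.

Let dphi0 i : pderiv i phi x 0 (lshift m 0) = 0.
Proof. by rewrite dphi row_mxEl mxE. Qed.

Let dphir i e : pderiv i phi x 0 (rshift 1 e) = pderiv i psi x 0 e.
Proof. by rewrite dphi row_mxEr. Qed.

Let cov_derivE i j : rsubmx (cov_deriv W phi x i j) = cov_deriv G psi x i j.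
Proof.
rewrite /cov_deriv linearD /= ddphi; congr (_ + _).
apply/rowP => a; rewrite [LHS]mxE [LHS]mxE [RHS]mxE.
rewrite big_split_ord /= big_ord1 [X in X + _ = _]big1 ?add0r; last first.
  by move=> e _; rewrite (dphi0 i) mulr0 mul0r.
apply: eq_bigr => b _; rewrite big_split_ord /= big_ord1.
rewrite (dphi0 j) mulr0 add0r; apply: eq_bigr => e _.
by rewrite (dphir i) (dphir j) (christoffel_space invW dxW).
Qed.

(** With no velocity in t, only Christoffel symbols with three spatial indices contribute to the
    spatial components, and these are those of [G]; first forms and projections agree as well. The
    t-component, which records how the slice bends, is dropped by [rsubmx]. *)
Lemma mean_curvature_slice :
  rsubmx (mean_curvature W phi x) = mean_curvature G psi x.
Proof.
rewrite /mean_curvature linear_sum; apply: eq_bigr => i _ /=.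
rewrite linear_sum; apply: eq_bigr => j _ /=.
rewrite linearZ /= first_formE; congr (_ *: _).
rewrite /second_form /normal_part linearB /= cov_derivE; congr (_ - _).
rewrite rsubmx_mul_metric cov_derivE first_formE JE mul_mx_row row_mxKr.
by [].
Qed.

End slice.

(** * Immersions into the product *)

Section time_coordinate.
Context {R : realType} {m : nat} (s : R).

(** The factor [s] turns a minimum of the height into a maximum, so one maximum principle serves
    both monotone cases. *)
Definition scaled_time (v : 'rV[R]_(1 + m)) : R := s * v 0 (lshift m 0).

Fact scaled_time_is_linear : linear scaled_time.
Proof. by move=> c v w; rewrite /scaled_time !mxE /GRing.scale /=; ring. Qed.
HB.instance Definition _ :=
  GRing.isLinear.Build R _ _ _ scaled_time scaled_time_is_linear.

Lemma scaled_time_continuous : continuous scaled_time.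
Proof.
move=> v; have cv : (fun w : 'rV[R]_(1 + m) => w 0 (lshift m 0)) @ v --> v 0 (lshift m 0).
  exact: coord_continuous.
exact: (cvgM (cvg_cst s) cv).
Qed.

End time_coordinate.

Section charts.
Context {R : realType} {I : set R} {oI : open I} {m : nat} {F : manifold R m}.
Variables (beta : R -> R) (g : R -> tensor F).
Hypotheses (beta_smooth : smooth_on I beta) (beta_gt0 : forall t, I t -> 0 < beta t).
Hypothesis g_metric : forall t, I t -> riemannian_metric (g t).
Hypothesis g_smooth : smooth_family I g.
Context {k : nat} {S : manifold R k}.
Variable f : S -> prod_manifold oI F.
Hypothesis f_minimal : minimal_immersion (sum_metric beta g) f.

Variables (t0 : set_type I) (a : chart S) (c : chart F).

Definition height (q : S) : R := \val (f q).1.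

Definition chart_overlap : set S := dom a `&` [set q | dom c (f q).2].

Let b : chart (prod_manifold oI F) := (t0, c).

Definition chart_map : 'rV[R]_k -> 'rV[R]_(1 + m) := local_rep f a b.

Definition chart_metric : 'rV[R]_(1 + m) -> 'M[R]_(1 + m) := sum_metric beta g b.

Local Notation phi := chart_map.
Local Notation W := chart_metric.
Local Notation U := (coord a @` chart_overlap).
Local Notation D := (coord c @` dom c).
Local Notation V := (warped_dom I D).

Lemma continuous_f : continuous f.
Proof. by have [[[]]] := f_minimal. Qed.

Lemma height_in q : I (height q).
Proof. exact/set_mem/(valP (f q).1). Qed.

Lemma open_chart_overlap : open chart_overlap.
Proof.
apply: openI; first exact: dom_open.
apply: (@open_comp _ _ f (@dom _ _ (prod_manifold oI F) b)); last exact: dom_open.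
by move=> q _; exact: continuous_f.
Qed.

Lemma open_chart_image : open U.
Proof. by apply: open_coord_image; [exact: open_chart_overlap|move=> q []]. Qed.

Lemma chart_map_smooth : smooth_on U phi.
Proof. by have [[[_ sf] _] _] := f_minimal; exact: (sf a b). Qed.

Lemma chart_mapE q : dom a q ->
  phi (coord a q) = row_mx (height q)%:M (coord c (f q).2).
Proof. by move=> aq; rewrite /chart_map /local_rep /= coordK. Qed.

Lemma lsubmx_chart_map q : dom a q -> lsubmx (phi (coord a q)) 0 0 = height q.
Proof. by move=> /chart_mapE ->; rewrite row_mxKl mxE eqxx. Qed.

Lemma rsubmx_chart_map q : dom a q -> rsubmx (phi (coord a q)) = coord c (f q).2.
Proof. by move=> /chart_mapE ->; rewrite row_mxKr. Qed.

Lemma time_chart_map q : dom a q -> phi (coord a q) 0 (lshift m 0) = height q.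
Proof. by move=> /chart_mapE ->; rewrite row_mxEl mxE eqxx. Qed.

Lemma chart_map_dom x : U x -> V (phi x).
Proof.
move=> [q [aq cq] <-]; rewrite /warped_dom /= lsubmx_chart_map// rsubmx_chart_map//.
by split; [exact: height_in|exists (f q).2].
Qed.

Lemma chart_metric_smooth : smooth_on V W.
Proof. by apply: (@warped_smooth _ _ I D beta (fun t => g t c)) => //; exact: image_open. Qed.

Lemma chart_metric_sym x : U x -> (W (phi x))^T = W (phi x).
Proof.
move=> [q [aq cq] <-]; have [gT _ _ _] := g_metric (height_in q).
rewrite /chart_metric /sum_metric lsubmx_chart_map// rsubmx_chart_map//=.
by rewrite tr_block_mx !trmx0 tr_scalar_mx gT.
Qed.

Lemma chart_metric_gt0 x v : U x -> v != 0 -> 0 < qform (W (phi x)) v.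
Proof.
move=> [q [aq cq] <-] v0; have [_ gP _ _] := g_metric (height_in q).
rewrite /chart_metric /sum_metric lsubmx_chart_map// rsubmx_chart_map//=.
apply: qform_block_gt0 => //; first exact/beta_gt0/height_in.
by move=> w; exact: gP.
Qed.

Lemma chart_metric_unit x : U x -> W (phi x) \in unitmx.
Proof. by move=> Ux; apply: spd_unitmx => v; exact: chart_metric_gt0. Qed.

Lemma invmx_chart_metric x : U x -> invmx (W (phi x)) =
  block_mx (beta (lsubmx (phi x) 0 0))^-1%:M 0 0
    (invmx (g (lsubmx (phi x) 0 0) c (rsubmx (phi x)))).
Proof.
by move=> /chart_metric_unit uW; rewrite invmx_block_diag// invmx_scalar.
Qed.

Lemma chart_map_free x : U x -> row_free ('J phi x).
Proof. by move=> [q [aq cq] <-]; have [[_ fr] _] := f_minimal; exact: fr. Qed.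

Lemma chart_map_minimal x : U x -> mean_curvature W phi x = 0.
Proof. by move=> [q [aq cq] <-]; have [_ mc] := f_minimal; exact: mc. Qed.

Lemma row_jacobian_chart_map x i : U x -> row i ('J phi x) = pderiv i phi x.
Proof. by move=> Ux; apply: jacobianE; exact: (chart_map_smooth [::]). Qed.

Lemma first_form_chart_gt0 x (v : 'rV[R]_k) : U x -> v != 0 ->
  0 < (v *m first_form W phi x *m v^T) 0 0.
Proof.
move=> Ux; apply: first_form_gt0; last exact: chart_map_free.
by move=> w; exact: chart_metric_gt0.
Qed.

Lemma first_form_chart_inv x : U x ->
  exists2 Q, Q \in unitmx & invmx (first_form W phi x) = Q^T *m Q.
Proof.
move=> Ux; apply: spd_invmx; first exact/first_form_sym/chart_metric_sym.
by move=> v; exact: first_form_chart_gt0.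
Qed.

Let drift_coef x := (2 * beta (lsubmx (phi x) 0 0))^-1 *
  derive1 beta (lsubmx (phi x) 0 0).

(** The coefficients involve two derivatives of the chart map and one of the metric, all continuous
    by smoothness; positivity of [W], of the first form and of [beta] lets the inverses pass to the
    limit. *)
Let cvg_chart_limits x : U x ->
  (fun y => invmx (first_form W phi y)) @ x --> invmx (first_form W phi x) /\
  (fun y => time_drift W phi (drift_coef y) y) @ x -->
  time_drift W phi (drift_coef x) x.
Proof.
move=> Ux; have oU := open_chart_image; have sphi := chart_map_smooth.
have Vx := chart_map_dom Ux.
have cphi i : pderiv i phi @ x --> pderiv i phi x.
  exact: differentiable_continuous (sphi [:: delta_mx 0 i] x Ux).
have cphi2 i j : pderiv i (pderiv j phi) @ x --> pderiv i (pderiv j phi) x.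
  exact: differentiable_continuous (sphi [:: delta_mx 0 j; delta_mx 0 i] x Ux).
have cJ := cvg_jacobian oU Ux sphi.
have cW : W \o phi @ x --> W (phi x).
  by apply: (cvg_smooth_comp Ux Vx sphi) => y Vy; exact: (chart_metric_smooth [::]).
have cdW e : pderiv e W \o phi @ x --> pderiv e W (phi x).
  apply: (cvg_smooth_comp Ux Vx sphi) => y Vy.
  exact: (chart_metric_smooth [:: delta_mx 0 e]).
have uW := chart_metric_unit Ux.
have uh : first_form W phi x \in unitmx.
  by apply: spd_unitmx => v; exact: first_form_chart_gt0.
have ch' : (fun y => invmx (first_form W phi y)) @ x --> invmx (first_form W phi x).
  exact: (cvg_invmx_first_form cJ cW uh).
split=> //; have Ih : I (lsubmx (phi x) 0 0) by have [] := Vx.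
have ch : (fun y => lsubmx (phi y) 0 0) @ x --> lsubmx (phi x) 0 0.
  have cp : phi @ x --> phi x.
    exact: differentiable_continuous (sphi [::] x Ux).
  have -> : (fun y => lsubmx (phi y) 0 0) = fun y => phi y 0 (lshift m 0).
    by apply/funext => y; rewrite mxE.
  by rewrite mxE; exact: cvg_entry cp.
have cb : (fun y => beta (lsubmx (phi y) 0 0)) @ x --> beta (lsubmx (phi x) 0 0).
  have cbeta := differentiable_continuous (beta_smooth [::] Ih).
  exact: (@continuous_comp _ _ _ (fun y => lsubmx (phi y) 0 0) beta x ch cbeta).
have cb' : (fun y => derive1 beta (lsubmx (phi y) 0 0)) @ x -->
    derive1 beta (lsubmx (phi x) 0 0).
  have -> : derive1 beta = 'D_1 beta by apply/funext => t; rewrite derive1E.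
  have cbeta := differentiable_continuous (beta_smooth [:: 1] Ih).
  exact: (@continuous_comp _ _ _ (fun y => lsubmx (phi y) 0 0) ('D_1 beta) x ch cbeta).
have b0 : 2 * beta (lsubmx (phi x) 0 0) != 0.
  by rewrite mulf_neq0// gt_eqF// beta_gt0.
have cc : drift_coef @ x --> drift_coef x.
  have c1 : (fun y => 2 * beta (lsubmx (phi y) 0 0)) @ x -->
      2 * beta (lsubmx (phi x) 0 0) by exact: (cvgM (cvg_cst (2 : R)) cb).
  have c2 : (fun y => (2 * beta (lsubmx (phi y) 0 0))^-1) @ x -->
      (2 * beta (lsubmx (phi x) 0 0))^-1 by exact: (cvgV b0 c1).
  exact: (cvgM c2 cb').
have ccov i j : (fun y => cov_deriv W phi y i j) @ x --> cov_deriv W phi x i j.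
  exact: (cvg_cov_deriv cphi cphi2 cW cdW uW).
exact: (cvg_time_drift cc cJ cW ccov ch').
Qed.

Let u (s : R) : 'rV[R]_k -> R := scaled_time s \o phi.

Let u_smooth s : smooth_on U (u s).
Proof.
apply: smooth_on_linear_comp; [exact: open_chart_image| |exact: chart_map_smooth].
exact: scaled_time_continuous.
Qed.

Let pderiv_u s j x : U x -> pderiv j (u s) x = scaled_time s (pderiv j phi x).
Proof.
move=> Ux; apply: derive_linear_comp; first exact: scaled_time_continuous.
exact: (chart_map_smooth [::]).
Qed.

Let hessian_u s x : U x -> hessian (u s) x =
  s *: \matrix_(i, j) pderiv i (pderiv j phi) x 0 (lshift m 0).
Proof.
move=> Ux; apply/matrixP => i j; rewrite !mxE.
have -> : pderiv i (pderiv j (u s)) x = 'D_(delta_mx 0 i) (scaled_time s \o pderiv j phi) x.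
  apply: (eq_derive_open _ open_chart_image); last exact/mem_set.
  by move=> y /set_mem Uy; exact: pderiv_u.
apply: derive_linear_comp; first exact: scaled_time_continuous.
exact: (chart_map_smooth [:: delta_mx 0 j]).
Qed.

(** Multiplying the t-component of H = 0 by [s] leaves a positive factor 1 / (2 beta) times a sum of
    terms s (d_t g)(X, X), one for each row of [Q]. *)
Let elliptic_u s x : U x ->
  (forall t p v, I t -> dom c p -> 0 <= s * qform (dt_family g t c (coord c p)) v) ->
  0 <= elliptic (invmx (first_form W phi x)) (time_drift W phi (drift_coef x) x) (u s) x.
Proof.
move=> Ux mono; have [Q _ hQ] := first_form_chart_inv Ux.
have Vx := chart_map_dom Ux.
have gs : smooth_on (I `*` D) (fun z => g z.1 c z.2) := @g_smooth c.
have dtW := @pderiv_time_warped _ _ I D beta (fun t => g t c) beta_smooth gs _ Vx.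
have dxW i := @pderiv_space_warped _ _ I D beta (fun t => g t c) beta_smooth gs _ i Vx.
have E := time_component_minimal (fun i => row_jacobian_chart_map i Ux)
  (invmx_chart_metric Ux) dtW dxW (chart_map_minimal Ux) hQ.
rewrite /elliptic hessian_u// frobZr.
have -> : \sum_l time_drift W phi (drift_coef x) x 0 l * pderiv l (u s) x =
    s * \sum_l time_drift W phi (drift_coef x) x 0 l * pderiv l phi x 0 (lshift m 0).
  by rewrite mulr_sumr; apply: eq_bigr => l _; rewrite pderiv_u// mulrCA.
rewrite -mulrDr; suff : 0 <= s * ((2 * beta (lsubmx (phi x) 0 0))^-1 *
    \sum_l qform (derive1 (fun t => g t c (rsubmx (phi x))) (lsubmx (phi x) 0 0))
      (row l Q *m rsubmx ('J phi x))) by rewrite -E.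
rewrite mulrCA mulr_ge0//.
  by rewrite invr_ge0 mulr_ge0// ltW// beta_gt0//; have [] := Vx.
rewrite mulr_sumr; apply: sumr_ge0 => l _.
have [Iy [p cp pE]] := Vx.
by have := mono _ p (row l Q *m rsubmx ('J phi x)) Iy cp; rewrite pE.
Qed.

Lemma height_max_near s M p :
  (forall t q v, I t -> dom c q -> 0 <= s * qform (dt_family g t c (coord c q)) v) ->
  (forall q, s * height q <= M) -> chart_overlap p -> s * height p = M ->
  \forall q \near p, s * height q = M.
Proof.
move=> mono hM Cp hp; have [ap cp] := Cp.
have uE q : dom a q -> u s (coord a q) = s * height q.
  by move=> aq; rewrite /u /= /scaled_time time_chart_map.
have near_max : \forall x \near coord a p, u s x = M.
  apply: (@strong_maximum_principle _ _ U (u s) (fun x => invmx (first_form W phi x))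
    (fun x => time_drift W phi (drift_coef x) x) M open_chart_image (u_smooth s)).
  - by move=> x /cvg_chart_limits[].
  - by move=> x /cvg_chart_limits[].
  - by move=> x /first_form_chart_inv.
  - by move=> x Ux; exact: elliptic_u.
  - by move=> _ [q [aq _] <-]; rewrite uE.
  - by exists p.
  - by rewrite uE.
have := coord_continuous_at ap near_max.
have : nbhs p (dom a) by apply: open_nbhs_nbhs; split => //; exact: dom_open.
by apply: filterS2 => q aq /=; rewrite uE.
Qed.

Section constant_height.
Variable t1 : R.
Hypothesis height_cst : forall q, height q = t1.

Let psi : 'rV[R]_k -> 'rV[R]_m := local_rep (fun q => (f q).2 : F) a c.

Let psiE : psi = rsubmx \o phi.
Proof.
by apply/funext => x; rewrite /psi /chart_map /local_rep /= /prod_coord /= row_mxKr.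
Qed.

Lemma slice_map_smooth : smooth_on U psi.
Proof.
rewrite psiE; apply: smooth_on_linear_comp; [exact: open_chart_image| |exact: chart_map_smooth].
exact: continuous_rsubmx.
Qed.

Let pderiv_psi i x : U x -> pderiv i psi x = rsubmx (pderiv i phi x).
Proof.
move=> Ux; rewrite psiE; apply: derive_linear_comp; first exact: continuous_rsubmx.
exact: (chart_map_smooth [::]).
Qed.

Let pderiv2_psi i j x : U x ->
  rsubmx (pderiv i (pderiv j phi) x) = pderiv i (pderiv j psi) x.
Proof.
move=> Ux; apply/esym.
have -> : pderiv i (pderiv j psi) x = 'D_(delta_mx 0 i) (rsubmx \o pderiv j phi) x.
  apply: (eq_derive_open _ open_chart_image); last exact/mem_set.
  by move=> y /set_mem Uy; exact: pderiv_psi.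
apply: derive_linear_comp; first exact: continuous_rsubmx.
exact: (chart_map_smooth [:: delta_mx 0 j]).
Qed.

(** [u 1] is the height read in the chart; it equals [t1] on the open set [U], so its derivatives
    vanish there. *)
Let pderiv_phi i x : U x -> pderiv i phi x = row_mx 0 (pderiv i psi x).
Proof.
move=> Ux; rewrite pderiv_psi// -[LHS]hsubmxK; congr row_mx.
apply/rowP => j; rewrite ord1 !mxE.
have <- : pderiv i (u 1) x = pderiv i phi x 0 (lshift m 0).
  by rewrite pderiv_u// /scaled_time mul1r.
suff -> : pderiv i (u 1) x = 'D_(delta_mx 0 i) (cst t1) x by rewrite derive_cst.
apply: (eq_derive_open _ open_chart_image); last exact/mem_set.
move=> y /set_mem [q [aq cq] <-].
by rewrite /u /= /scaled_time time_chart_map// height_cst mul1r.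
Qed.

Let jacobian_phi x : U x -> 'J phi x = row_mx 0 ('J psi x).
Proof.
move=> Ux; apply/row_matrixP => i; rewrite row_jacobian_chart_map// row_row_mx row0.
rewrite jacobianE; first exact: pderiv_phi.
exact: (slice_map_smooth [::]).
Qed.

Lemma slice_map_free x : U x -> row_free ('J psi x).
Proof.
move=> Ux; apply: inj_row_free => v vJ.
have := chart_map_free Ux; rewrite jacobian_phi// => /row_free_inj.
by apply; rewrite mul_mx_row vJ mul0mx mulmx0 row_mx0.
Qed.

Lemma slice_map_minimal x : U x -> mean_curvature (g t1 c) psi x = 0.
Proof.
move=> Ux; have Vx := chart_map_dom Ux.
have tx : lsubmx (phi x) 0 0 = t1.
  by case: Ux => q [aq cq] <-; rewrite lsubmx_chart_map.
have rx : rsubmx (phi x) = psi x by rewrite psiE.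
have gs : smooth_on (I `*` D) (fun z => g z.1 c z.2) := @g_smooth c.
have dxW i := @pderiv_space_warped _ _ I D beta (fun t => g t c) beta_smooth gs _ i Vx.
have WE : W (phi x) = block_mx (beta t1)%:M 0 0 (g t1 c (psi x)).
  by rewrite /chart_metric /sum_metric tx rx.
rewrite -(mean_curvature_slice WE (chart_metric_unit Ux) _ (fun i => pderiv_phi i Ux)
  (fun i j => pderiv2_psi i j Ux) (jacobian_phi Ux)).
  by rewrite chart_map_minimal// linear0.
by move=> i; have := dxW i; rewrite tx rx.
Qed.

End constant_height.

End charts.

(** * From local to global: compact connected submanifolds *)

Lemma constant_height (R : realType) (I : set R) (oI : open I)
    (m : nat) (F : manifold R m) (beta : R -> R) (g : R -> tensor F)
    (k : nat) (S : manifold R k) (f : S -> prod_manifold oI F) (s : R) :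
  smooth_on I beta -> (forall t, I t -> 0 < beta t) ->
  (forall t, I t -> riemannian_metric (g t)) -> smooth_family I g ->
  minimal_immersion (sum_metric beta g) f ->
  compact [set: S] -> connected [set: S] ->
  (forall t c q v, I t -> dom c q -> 0 <= s * qform (dt_family g t c (coord c q)) v) ->
  forall p q, s * height f p = s * height f q.
Proof.
move=> beta_smooth beta_gt0 g_metric g_smooth f_minimal S_compact S_connected mono p0.
pose h q := s * height f q.
have ch : continuous h.
  move=> q; have c1 : {for q, continuous (fst \o f)}.
    apply: continuous_comp; first exact: (continuous_f f_minimal).
    exact: cvg_fst.
  have c2 : {for q, continuous (height f)}.
    apply: (@continuous_comp _ _ _ (fst \o f) (set_val : set_type I -> R)) => //.
    exact: (@initial_continuous _ _ (set_val : set_type I -> R)).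
  exact: (cvgM (cvg_cst s) c2).
have [pM _ hM] : exists2 p, p \in [set: S] & forall q, q \in [set: S] -> h q <= h p.
  apply: compact_EVT_max => //; first by exists p0.
  by apply: continuous_subspaceT.
have {}hM q : h q <= h pM by apply: hM; exact: in_setT.
suff top : [set q | h q = h pM] = setT.
  have E q : h q = h pM by have : [set q | h q = h pM] q by rewrite top.
  by move=> q; rewrite -/(h p0) -/(h q) !E.
apply: S_connected; first by exists pM.
- exists [set q | h q = h pM]; last by rewrite setTI.
  rewrite openE => p /= hp.
  have [a ap] := dom_cover p; have [c cp] := dom_cover (f p).2.
  apply: (@height_max_near _ _ _ _ _ beta g _ _ _ _ _ _ f f_minimal (f p).1 a c) => //.
  by move=> t q v It cq; exact: mono.
- exists [set q | h q = h pM]; last by rewrite setTI.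
  by apply: (@closed_comp _ _ h [set y | y = h pM]) => // ; exact: closed_eq.
Qed.

Theorem theorem2 (R : realType) (I : set R) (oI : open I)
    (itvI : is_interval I) (I0 : I !=set0)
    (m : nat) (F : manifold R m) (beta : R -> R) (g : R -> tensor F)
    (beta_smooth : smooth_on I beta) (beta_gt0 : forall t, I t -> 0 < beta t)
    (g_metric : forall t, I t -> riemannian_metric (g t))
    (g_smooth : smooth_family I g)
    (mono : monotone_metric I beta g)
    (k : nat) (S : manifold R k) (f : S -> prod_manifold oI F)
    (k_gt0 : (0 < k)%N)
    (S_compact : compact [set: S]) (S_connected : connected [set: S])
    (f_minimal : minimal_immersion (sum_metric beta g) f) :
  exists t0 : R, [/\ I t0,
    forall p : S, \val (f p).1 = t0 &
    (1 < (1 + m) - k)%N ->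
      minimal_immersion (g t0) (fun p : S => (f p).2)].
Proof.
have [s s0 smono] : exists2 s : R, s != 0 & forall t c q v, I t -> dom c q ->
    0 <= s * qform (dt_family g t c (coord c q)) v.
  (* The sign is 1 in the non-shrinking case and -1 in the non-expanding one. *)
  have [[_ gP]|[_ gN]] := mono.
    by exists 1 => // t c q v It cq; rewrite mul1r gP.
  exists (- 1); first by rewrite oppr_eq0 oner_eq0.
  by move=> t c q v It cq; rewrite mulN1r oppr_ge0 gN.
have hcst p q : height f p = height f q.
  apply: (mulfI s0).
  exact: (constant_height beta_smooth beta_gt0 g_metric g_smooth f_minimal).
have [t0 It0 ht0] : exists2 t0 : R, I t0 & forall p : S, height f p = t0.
  (* [connected] admits the empty space; any level of the nonempty [I] then works. *)
  have [[p0 _]|S0] := pselect ([set: S] !=set0).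
    by exists (height f p0) => //; exact: height_in.
  have [t It] := I0; exists t => // p.
  by exfalso; apply: S0; exists p.
exists t0; split=> // _.
split; first split; first split.
- move=> p; apply: (@continuous_comp _ _ _ f snd p); last exact: cvg_snd.
  exact: (continuous_f f_minimal).
(* A chart of the product requires an element of [set_type I]; a point [q] of [S] over [x] supplies
   [(f q).1]. *)
- move=> a c v x Ux; have [q _ _] := Ux.
  exact: (slice_map_smooth f_minimal (f q).1 (a := a) (c := c) v Ux).
- move=> a c p ap cp.
  apply: (slice_map_free f_minimal (f p).1 ht0); by exists p.
- move=> a c p ap cp.
  apply: (slice_map_minimal beta_smooth beta_gt0 g_metric g_smooth f_minimal (f p).1 ht0).
  by exists p.
Qed.
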